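(* Let $\pi$ be a Clairaut slant Riemannian map with $s=e^f$ and slant angle $\theta$ from a Riemannian manifold $(P,g_P)$ to a Kähler manifold $(Q,g_Q,J')$ of dimension $q$, such that $(\mathrm{range}\,\pi_* )^\perp$ is totally geodesic and $\ker\pi_*$ is minimal. Then $\pi$ is harmonic if and only if $$\frac{\csc^2\theta}{q}\,\mathrm{trace}\left\{-\nabla^{\pi\perp}_X\delta\alpha\pi_*X+\delta S_{\delta\pi_*X}\pi_*X-C\nabla^{\pi\perp}_X\delta\pi_*X\right\}=0,$$ where $X\in\Gamma((\ker\pi_* )^\perp)$.
   Context: A smooth map $\pi:(P,g_P)\to(Q,g_Q)$ between Riemannian manifolds is a Riemannian map if $g_Q(\pi_*X,\pi_*Y)=g_P(X,Y)$ for all $X,Y\in\Gamma((\ker\pi_* )^\perp)$. One has $TP=\ker\pi_*\oplus(\ker\pi_* )^\perp$, and along $\pi$, $TQ=\mathrm{range}\,\pi_*\oplus(\mathrm{range}\,\pi_* )^\perp$ (with $(\mathrm{range}\,\pi_* )^\perp\ne0$). A Kähler manifold $(Q,g_Q,J')$: $J'^2=-I$, $g_Q(J'X,J'Y)=g_Q(X,Y)$, and $\nabla^QJ'=0$. A Riemannian map to an almost Hermitian manifold is slant with slant angle $\theta$ if for every non-zero $X\in\Gamma((\ker\pi_* )^\perp)$ the angle between $J'\pi_*X$ and $\mathrm{range}\,\pi_*$ is the constant $\theta$, independent of the point and of the vector. A Riemannian map $\pi$ is Clairaut (with function $s$) if there is a function $s:Q\to\mathbb{R}^+$ such that for every geodesic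 $\eta$ on $Q$ the function $(s\circ\eta)\sin\omega(t)$ is constant, where $\pi_*X\in\Gamma(\mathrm{range}\,\pi_* )$ and $U\in\Gamma((\mathrm{range}\,\pi_* )^\perp)$ are the components of $\dot\eta(t)$, and $\omega(t)$ is the angle between $\dot\eta(t)$ and $U$. A Clairaut slant Riemannian map is a slant Riemannian map to a Kähler manifold that is Clairaut; $s=e^f$ with $f$ a smooth function on $Q$. $\nabla^P,\nabla^Q$ are the Levi-Civita connections, $\nabla^{Q_\pi}$ is the pullback connection of $\nabla^Q$ along $\pi$. The second fundamental form is $(\nabla\pi_* )(X,Y)=\nabla^{Q_\pi}_X\pi_*Y-\pi_*(\nabla^P_XY)$; $\pi$ is harmonic if its tension field $\tau(\pi)=\mathrm{trace}(\nabla\pi_* )$ vanishes. $\ker\pi_*$ is minimal when the fibers of $\pi$ are minimal submanifolds of $P$. For $X\in\Gamma((\ker\pi_* )^\perp)$ and $V\in\Gamma((\mathrm{range}\,\pi_* )^\perp)$, write $\nabla^Q_{\pi_*X}V=-S_V\pi_*X+\nabla^{\pi\perp}_XV$, with $S_V\pi_*X\in\mathrm{range}\,\pi_*$ and $\nabla^{\pi\perp}_XV\in(\mathrm{range}\,\pi_* )^\perp$. The trace of an expression in $X$ is the sum of its values over a local orthonormal frame of $(\ker\pi_* )^\perp$. For $\pi_*Y\in\Gamma(\mathrm{range}\,\pi_* )$ write $J'\pi_*Y=\alpha\pi_*Y+\delta\pi_*Y$ with $\alpha\pi_*Y\in\Gamma(\mathrm{range}\,\pi_* )$, $\delta\pi_*Y\in\Gamma((\mathrm{range}\,\pi_*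 )^\perp)$; for $U\in\Gamma((\mathrm{range}\,\pi_* )^\perp)$ write $J'U=BU+CU$ with $BU\in\Gamma(\mathrm{range}\,\pi_* )$, $CU\in\Gamma((\mathrm{range}\,\pi_* )^\perp)$. *)

(* Defs.v *)
(* Smooth manifolds carry one preferred chart [chart p] around each point [p].
   A tangent vector at [p] is represented by its coordinates in [chart p], so
   every tangent space is ['rV[R]_n] and a vector field is a map
   [M -> 'rV[R]_n]; [tchange] converts between the charts.  All fields are total
   functions, and local fields are total functions smooth near a point. *)
From HB Require Import structures.
From mathcomp Require Import all_boot all_order all_algebra.
From mathcomp Require Import all_classical all_reals all_analysis.

Set Implicit Arguments.
Unset Strict Implicit.
Unset Printing Implicit Defensive.

Import Order.TTheory GRing.Theory Num.Theory.
Import numFieldNormedType.Exports.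

Local Open Scope classical_set_scope.
Local Open Scope ring_scope.

Section Smooth.
Context {R : realType} {E F : normedModType R}.

(* Only meant for an open [U] and finite-dimensional [E]. *)
Fixpoint Ck (k : nat) (U : set E) (f : E -> F) : Prop :=
  match k with
  | 0 => forall x, U x -> {for x, continuous f}
  | k'.+1 => (forall x, U x -> differentiable f x) /\
             (forall v, Ck k' U (fun x => 'D_v f x))
  end.

Definition smooth_on (U : set E) (f : E -> F) := forall k, Ck k U f.

Definition smooth_at (f : E -> F) (x : E) :=
  exists U : set E, [/\ open U, U x & smooth_on U f].

End Smooth.

Record manifold (R : realType) (n : nat) := Manifold {
  mcarrier :> topologicalType;
  chart_dom : mcarrier -> set mcarrier;
  chart : mcarrier -> mcarrier -> 'rV[R]_n;
  chart_inv : mcarrier -> 'rV[R]_n -> mcarrier;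
  manifold_hausdorff : hausdorff_space mcarrier;
  manifold_second_countable : @second_countable mcarrier;
  chart_dom_open : forall p, open (chart_dom p);
  chart_dom_center : forall p, chart_dom p p;
  chart_img_open : forall p, open (chart p @` chart_dom p);
  chartK : forall p x, chart_dom p x -> chart_inv p (chart p x) = x;
  chart_continuous : forall p x, chart_dom p x -> {for x, continuous (chart p)};
  chart_inv_continuous : forall p y, (chart p @` chart_dom p) y ->
    {for y, continuous (chart_inv p)};
  chart_transition : forall p q,
    smooth_on (chart p @` (chart_dom p `&` chart_dom q)) (chart q \o chart_inv p)
}.

Arguments chart_dom {R n M} : rename.
Arguments chart {R n M} : rename.
Arguments chart_inv {R n M} : rename.

Section Fields.
Context {R : realType} {n : nat} {M : manifold R n}.

(* Coordinates in [chart b] of the vector at [x] with coordinates [v] in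
   [chart a]. *)
Definition tchange (a b x : M) (v : 'rV[R]_n) : 'rV[R]_n :=
  'd (chart b \o chart_inv a) (chart a x) v.

Definition smooth_fun_at (f : M -> R) (p : M) :=
  smooth_at (fun z => f (chart_inv p z) : R^o) (chart p p).

Definition smooth_fun (f : M -> R) := forall p, smooth_fun_at f p.

Definition dfun (f : M -> R) (p : M) (v : 'rV[R]_n) : R :=
  'd (fun z => f (chart_inv p z) : R^o) (chart p p) v.

Definition field_coords (Y : M -> 'rV[R]_n) (p : M) (z : 'rV[R]_n) : 'rV[R]_n :=
  let x := chart_inv p z in tchange x p x (Y x).

Definition field_smooth_at (Y : M -> 'rV[R]_n) (p : M) :=
  smooth_at (field_coords Y p) (chart p p).

Definition lie_bracket (X Y : M -> 'rV[R]_n) (p : M) : 'rV[R]_n :=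
  'd (field_coords Y p) (chart p p) (X p) - 'd (field_coords X p) (chart p p) (Y p).

(* The field with constant coordinates [w] in [chart p]. *)
Definition const_field (p : M) (w : 'rV[R]_n) : M -> 'rV[R]_n :=
  fun x => tchange p x x w.

Definition tensor2 := M -> 'rV[R]_n -> 'rV[R]_n -> R.

Definition riemannian_metric (g : tensor2) : Prop :=
  [/\ forall p u (a : R) v w, g p (a *: v + w) u = a * g p v u + g p w u,
      forall p v w, g p v w = g p w v,
      forall p v, v != 0 -> 0 < g p v v
    & forall p Y Z, field_smooth_at Y p -> field_smooth_at Z p ->
        smooth_fun_at (fun x => g x (Y x) (Z x)) p].

(* [nabla p v Y] is the covariant derivative at [p] of the field [Y], smooth near
   [p], in the direction [v]. *)
Definition conn_op := M -> 'rV[R]_n -> (M -> 'rV[R]_n) -> 'rV[R]_n.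

Record affine_connection (nabla : conn_op) : Prop := AffineConnection {
  conn_local : forall p v Y Z, field_smooth_at Y p -> field_smooth_at Z p ->
    (\forall x \near p, Y x = Z x) -> nabla p v Y = nabla p v Z;
  conn_linear_dir : forall p Y (a : R) v w, field_smooth_at Y p ->
    nabla p (a *: v + w) Y = a *: nabla p v Y + nabla p w Y;
  conn_add : forall p v Y Z, field_smooth_at Y p -> field_smooth_at Z p ->
    nabla p v (fun x => Y x + Z x) = nabla p v Y + nabla p v Z;
  conn_leibniz : forall p v (f : M -> R) Y,
    smooth_fun_at f p -> field_smooth_at Y p ->
    nabla p v (fun x => f x *: Y x) = dfun f p v *: Y p + f p *: nabla p v Y;
  conn_smooth : forall p X Y, field_smooth_at X p -> field_smooth_at Y p ->
    field_smooth_at (fun x => nabla x (X x) Y) p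
}.

Definition levi_civita (g : tensor2) (nabla : conn_op) : Prop :=
  [/\ affine_connection nabla,
      forall p X Y, field_smooth_at X p -> field_smooth_at Y p ->
        nabla p (X p) Y - nabla p (Y p) X = lie_bracket X Y p
    & forall p v Y Z, field_smooth_at Y p -> field_smooth_at Z p ->
        dfun (fun x => g x (Y x) (Z x)) p v =
          g p (nabla p v Y) (Z p) + g p (Y p) (nabla p v Z)].

Definition christoffel (nabla : conn_op) (p : M) (v w : 'rV[R]_n) : 'rV[R]_n :=
  nabla p v (const_field p w).

(* For a map [h] from an open part of a normed space to [M] and a section [W]
   along [h]: the covariant derivative of [W] at [y] in the direction [u] for the
   pullback of [nabla] by [h], in the coordinates given by [chart (h y)], namely
   dW(u) + Gamma(dh(u), W). *)
Definition cov_along {E : normedModType R} (nabla : conn_op)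
    (h : E -> M) (W : E -> 'rV[R]_n) (y u : E) : 'rV[R]_n :=
  'd (fun z => tchange (h z) (h y) (h z) (W z)) y u
  + christoffel nabla (h y) ('d (chart (h y) \o h) y u) (W y).

Definition velocity (eta : R -> M) (t : R) : 'rV[R]_n :=
  'd ((chart (eta t) \o eta) : R^o -> _) t 1.

Definition geodesic (nabla : conn_op) (I : set R) (eta : R -> M) : Prop :=
  [/\ open I, is_interval I &
      forall t, I t ->
        [/\ {for t, continuous eta},
            smooth_at ((chart (eta t) \o eta) : R^o -> _) t
          & cov_along (E := R^o) nabla eta (velocity eta) t 1 = 0]].

(* [X 0, ..., X (k-1)] is a local orthonormal frame near [p] of the distribution
   [D]. *)
Definition frame_near (g : tensor2) (D : M -> set 'rV[R]_n) (p : M) (k : nat)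
    (X : 'I_k -> M -> 'rV[R]_n) : Prop :=
  (forall i, field_smooth_at (X i) p) /\
  \forall x \near p,
    [/\ forall i, D x (X i x),
        forall i j, g x (X i x) (X j x) = (i == j)%:R
      & forall v, D x v -> exists a : 'I_k -> R, v = \sum_i a i *: X i x].

(* [t] is the sum of the values at [p] of [T] over a local orthonormal frame
   of [D]. *)
Definition is_trace {r : nat} (g : tensor2) (D : M -> set 'rV[R]_n)
    (T : M -> (M -> 'rV[R]_n) -> 'rV[R]_r) (p : M) (t : 'rV[R]_r) : Prop :=
  exists (k : nat) (X : 'I_k -> M -> 'rV[R]_n),
    frame_near g D p X /\ t = \sum_i T p (X i).

Definition totally_geodesic_on (nabla : conn_op) (O : set M)
    (D : M -> set 'rV[R]_n) : Prop :=
  forall y U V, O y -> field_smooth_at U y -> field_smooth_at V y ->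
    (\forall x \near y, D x (U x) /\ D x (V x)) -> D y (nabla y (U y) V).

Definition kahler (g : tensor2) (nabla : conn_op)
    (J : M -> 'rV[R]_n -> 'rV[R]_n) : Prop :=
  [/\ forall y (a : R) v w, J y (a *: v + w) = a *: J y v + J y w,
      forall y Y, field_smooth_at Y y -> field_smooth_at (fun x => J x (Y x)) y,
      forall y v, J y (J y v) = - v,
      forall y v w, g y (J y v) (J y w) = g y v w
    & forall y v Y, field_smooth_at Y y ->
        nabla y v (fun x => J x (Y x)) = J y (nabla y v Y)].

End Fields.

Arguments tensor2 {R n} M.
Arguments conn_op {R n} M.

Section InnerProduct.
Context {R : realType} {n : nat}.
Implicit Types (b : 'rV[R]_n -> 'rV[R]_n -> R) (S : set 'rV[R]_n).

Definition orth b S : set 'rV[R]_n := [set u | forall v, S v -> b u v = 0].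

Definition oproj b S (u : 'rV[R]_n) : 'rV[R]_n :=
  xget 0 [set a | S a /\ orth b S (u - a)].

(* The angle with the zero vector is pi/2, as [x / 0 = 0] and [acos 0 = pi/2]. *)
Definition angle b (u v : 'rV[R]_n) : R :=
  acos (b u v / (Num.sqrt (b u u) * Num.sqrt (b v v))).

Definition angle_subspace b (u : 'rV[R]_n) S : R := angle b u (oproj b S u).

End InnerProduct.

Definition csc {R : realType} (x : R) : R := (sin x)^-1.

Section Maps.
Context {R : realType} {m q : nat} {P : manifold R m} {Q : manifold R q}.
Variables (gP : tensor2 P) (gQ : tensor2 Q) (nablaP : conn_op P) (nablaQ : conn_op Q).
Variables (J : Q -> 'rV[R]_q -> 'rV[R]_q) (pi : P -> Q).

Definition smooth_map : Prop :=
  forall p, {for p, continuous pi} /\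
    smooth_at (chart (pi p) \o pi \o chart_inv p) (chart p p).

Definition dmap (p : P) (v : 'rV[R]_m) : 'rV[R]_q :=
  'd (chart (pi p) \o pi \o chart_inv p) (chart p p) v.

Definition dker (p : P) : set 'rV[R]_m := [set v | dmap p v = 0].
Definition dker_orth (p : P) : set 'rV[R]_m := orth (gP p) (dker p).
Definition drange (p : P) : set 'rV[R]_q := range (dmap p).
Definition drange_orth (p : P) : set 'rV[R]_q := orth (gQ (pi p)) (drange p).

Definition riemannian_map : Prop :=
  [/\ smooth_map,
      forall p v w, dker_orth p v -> dker_orth p w ->
        gQ (pi p) (dmap p v) (dmap p w) = gP p v w
    & forall p, exists2 u, drange_orth p u & u != 0].

Definition range_part (p : P) : 'rV[R]_q -> 'rV[R]_q :=
  oproj (gQ (pi p)) (drange p).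
Definition normal_part (p : P) : 'rV[R]_q -> 'rV[R]_q :=
  oproj (gQ (pi p)) (drange_orth p).

Definition slant (theta : R) : Prop :=
  forall p v, dker_orth p v -> v != 0 ->
    angle_subspace (gQ (pi p)) (J (pi p) (dmap p v)) (drange p) = theta.

(* The splitting of the velocity of [eta] at time [t] is along [pi]: it makes
   sense at the points [p] of [P] with [pi p = eta t]. *)
Definition clairaut (s : Q -> R) : Prop :=
  (forall y, 0 < s y) /\
  forall (I : set R) (eta : R -> Q), geodesic nablaQ I eta ->
    let omega p t := angle (gQ (eta t)) (velocity eta t)
                           (normal_part p (velocity eta t)) in
    forall t1 t2 p1 p2, I t1 -> I t2 -> pi p1 = eta t1 -> pi p2 = eta t2 ->
      s (eta t1) * sin (omega p1 t1) = s (eta t2) * sin (omega p2 t2).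

Definition pullback_conn (p : P) (v : 'rV[R]_m) (W : P -> 'rV[R]_q) : 'rV[R]_q :=
  cov_along nablaQ (pi \o chart_inv p) (W \o chart_inv p) (chart p p) v.

Definition push (X : P -> 'rV[R]_m) : P -> 'rV[R]_q := fun x => dmap x (X x).

Definition second_fund_form (p : P) (X Y : P -> 'rV[R]_m) : 'rV[R]_q :=
  pullback_conn p (X p) (push Y) - dmap p (nablaP p (X p) Y).

Definition harmonic_map : Prop :=
  forall p t,
    is_trace gP (fun=> setT) (fun x X => second_fund_form x X X) p t -> t = 0.

(* The mean curvature of the fibers is the trace over the vertical distribution
   of their second fundamental form, the horizontal part of nabla_V V. *)
Definition minimal_kernel : Prop :=
  forall p t,
    is_trace gP dker
      (fun x V => oproj (gP x) (dker_orth x) (nablaP x (V x) V)) p t -> t = 0.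

(* The normal spaces are only given along [pi], so [nabla_U V] for [U], [V] normal
   has no meaning at first. Locally, they are required to be the restriction
   along [pi] of a smooth totally geodesic distribution of [Q]. *)
Definition totally_geodesic_normal : Prop :=
  forall p, exists (O : set Q) (D : Q -> set 'rV[R]_q),
    [/\ open O /\ O (pi p),
        forall y, O y -> exists (k : nat) (X : 'I_k -> Q -> 'rV[R]_q),
          frame_near gQ D y X,
        \forall x \near p, D (pi x) = drange_orth x
      & totally_geodesic_on nablaQ O D].

Definition normal_conn (p : P) (X : P -> 'rV[R]_m) (V : P -> 'rV[R]_q) : 'rV[R]_q :=
  normal_part p (pullback_conn p (X p) V).

(* [shape V X p] is S_V (pi_* X) at [p]. *)
Definition shape (V : P -> 'rV[R]_q) (X : P -> 'rV[R]_m) (p : P) : 'rV[R]_q :=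
  - range_part p (pullback_conn p (X p) V).

Definition alpha_part (p : P) (u : 'rV[R]_q) := range_part p (J (pi p) u).
Definition delta_part (p : P) (u : 'rV[R]_q) := normal_part p (J (pi p) u).
Definition C_part (p : P) (u : 'rV[R]_q) := normal_part p (J (pi p) u).

Definition harmonicity_integrand (p : P) (X : P -> 'rV[R]_m) : 'rV[R]_q :=
  let delta_X x := delta_part x (push X x) in
  let delta_alpha_X x := delta_part x (alpha_part x (push X x)) in
  - normal_conn p X delta_alpha_X
  + delta_part p (shape delta_X X p)
  - C_part p (normal_conn p X delta_X).

End Maps.

(* Main.v *)
(** The theorem rests on one pointwise identity.  Let [c = cos theta ^+ 2].  For
    [W = pi_* X] with [X] horizontal, slantness gives [alpha (alpha W) = - c W].
    As [J] is parallel,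
      [nabla_X (alpha W) + nabla_X (delta W) = J (nabla_X W)] and
      [nabla_X (delta (alpha W)) = J (nabla_X (alpha W)) + c (nabla_X W)].
    Applying [J] to the first equation and eliminating [nabla_X (alpha W)] shows
    that the integrand at [X] is [sin theta ^+ 2] times the normal part of
    [nabla_X W].  Let [B] be the second fundamental form of [pi].  For horizontal [X]
    that normal part is the whole of [B (X, X)], because the trilinear form
    [g_Q (B (X, Y), pi_* Z)] on horizontal vectors is symmetric in [X, Y] and skew
    in [Y, Z].  Minimality of the fibers removes the vertical contribution to the
    tension field, so the trace of the integrand is [sin theta ^+ 2] times the
    tension field. *)
Require Import Defs.
From HB Require Import structures.
From mathcomp Require Import all_boot all_order all_algebra.
From mathcomp Require Import ring lra.
From mathcomp Require Import all_classical all_reals all_analysis.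

Set Implicit Arguments.
Unset Strict Implicit.
Unset Printing Implicit Defensive.

Import Order.TTheory GRing.Theory Num.Theory.
Import numFieldNormedType.Exports.

Local Open Scope classical_set_scope.
Local Open Scope ring_scope.

(** * Differential calculus *)

(** The main obstacle is regularity. Orthogonal projections are chosen pointwise by [oproj], so
    neither the differentiability of [alpha_part] and [delta_part] along a field nor the constancy
    of the rank of [pi] is available at the start. Both come from the horizontal projector, which is
    smooth because it is the differential of [pi] followed by its metric adjoint: it produces smooth
    horizontal and vertical frames, and in such frames [alpha_part] has differentiable coefficients.
    Orthonormal frames also give the skewness of the trilinear form, since the products of their
    members, before and after pushing forward, are constant functions. In the elimination, the
    factor [sin theta ^+ 2] arises as [1 - c]: the 1 comes from [J] squared and the [- c] from
    [alpha] squared. Traces are quantified over frames, so each direction of the equivalence must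
    exhibit a frame of the other kind. The values can be compared because the second fundamental
    form depends only on the vectors at the point and is bilinear in them. *)

Section Diff.
Context {R : realType} {E F : normedModType R}.
Implicit Types (f g : E -> F) (x u : E).

(** The differential is a chosen function, so its locality needs an argument: the first-order
    expansion of [f] is also one of [g], and such expansions are unique. *)
Lemma near_eq_diff f g x : (\forall z \near x, f z = g z) -> differentiable f x ->
  differentiable g x /\ 'd g x = 'd f x :> (E -> F).
Proof.
move=> fg df; have [cf ef] := (diff_locallyP x f).1 df.
have eg : g \o shift x = cst (g x) + 'd f x +o_ 0 id.
  apply/eqaddoE/eqaddoP => e e0; move/eqaddoP : ef => /(_ e e0).
  have fg0 : \forall y \near 0, f (y + x) = g (y + x).
    by move: fg; rewrite (near_shift 0); apply: filterS => y /=; rewrite subr0.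
  apply: filterS2 fg0 => y.
  by rewrite /= /shift /cst /= !fctE /= => ->; rewrite (nbhs_singleton fg).
have dg := diff_unique cf eg.
split; last exact: dg.
by apply/diff_locallyP; rewrite dg; exact: conj cf eg.
Qed.

Lemma diff_scale (k : E -> R^o) f x : differentiable k x -> differentiable f x ->
  differentiable (fun z => k z *: f z) x /\
  forall u, 'd (fun z => k z *: f z) x u = k x *: 'd f x u + 'd k x u *: f x.
Proof.
move=> dk df.
(* Scaling is packed as a continuous bilinear map, so that the product rule is the chain rule
   applied to the pair of [k] and [f]. *)
have bl : bilinear_for (GRing.Scale.Law.clone _ _ *:%R _)
    (GRing.Scale.Law.clone _ _ *:%R _) ( *:%R : R^o -> F -> F).
  split=> [u' a x1 y|u a x1 y] /=; first by rewrite scalerDl scalerA.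
  by rewrite scalerDr !scalerA mulrC.
pose M := bilinear_isBilinear.Build R R^o F F _ _ ( *:%R : R^o -> F -> F) bl.
pose L : {bilinear R^o -> F -> F} := HB.pack ( *:%R : R^o -> F -> F) M.
have cL : continuous (fun p : R^o * F => L p.1 p.2) by exact: scale_continuous.
pose h := fun p : R^o * F => L p.1 p.2; pose l z : R^o * F := (k z, f z).
have dl : differentiable l x by exact: differentiable_pair.
have dh : differentiable h (l x) by exact: differentiable_bilin.
have eh : 'd h (l x) = (fun q => k x *: q.2 + q.1 *: f x) :> (_ -> _).
  by rewrite (diff_bilin (l x) cL).
have el : 'd l x = (fun y => ('d k x y, 'd f x y)) :> (_ -> _).
  exact: diff_pair.
rewrite -[fun z => _]/(h \o l).
split=> [|u]; first exact: differentiable_comp.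
by rewrite (diff_comp dl dh) eh el.
Qed.

End Diff.

(** Composites of charts agree with a given map only near a point, and the image point is often
    known under another name. Hence the separate [k] and [y]. *)
Lemma diff_chain (R : realType) (E F G : normedModType R) (f : E -> F) (g : F -> G)
    (k : E -> G) x y : f x = y -> differentiable f x -> differentiable g y ->
  (\forall z \near x, g (f z) = k z) ->
  differentiable k x /\ forall u, 'd k x u = 'd g y ('d f x u).
Proof.
move=> <- df dg e; have dgf := differentiable_comp df dg.
have [dk ek] := near_eq_diff (f := g \o f) e dgf.
by split=> // u; rewrite (congr1 (fun h : _ -> _ => h u) ek) (diff_comp df dg).
Qed.

Section Ck.
Context {R : realType} {E : normedModType R}.
Implicit Types (F G : normedModType R) (k : nat) (U V : set E).

Lemma Ck_ext F k U (f g : E -> F) : open U -> (forall x, U x -> f x = g x) ->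
  Ck k U f -> Ck k U g.
Proof.
move=> oU; elim: k f g => [|k IH] f g fg /=.
  move=> cf x Ux; have : f z @[z --> x] --> f x by exact: cf.
  rewrite (fg _ Ux); apply: cvg_trans.
  apply: near_eq_cvg; near=> z; apply: fg; near: z.
  exact: open_nbhs_nbhs.
move=> [df Df]; have nfg x : U x -> \forall z \near x, f z = g z.
  by move=> Ux; near=> z; apply: fg; near: z; exact: open_nbhs_nbhs.
split=> [x Ux|v].
  by have [] := near_eq_diff (nfg x Ux) (df x Ux).
by apply: IH (Df v) => x Ux; apply: near_eq_derive; exact: nfg.
Unshelve. all: by end_near. Qed.

Lemma Ck_sub F k U V (f : E -> F) : V `<=` U -> Ck k U f -> Ck k V f.
Proof.
move=> VU; elim: k f => [|k IH] f /=; first by move=> cf x /VU; exact: cf.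
by move=> [df Df]; split=> [x /VU|v]; [exact: df|exact: IH].
Qed.

Lemma CkW F k U (f : E -> F) : Ck k.+1 U f -> Ck k U f.
Proof.
elim: k f => [|k IH] f [df Df]; last by split=> // v; apply: IH; exact: Df.
by move=> x Ux; apply: differentiable_continuous; exact: df.
Qed.

Lemma Ck_cst F k U (a : F) : Ck k U (fun=> a).
Proof.
elim: k a => [|k IH] a; first by move=> x _; exact: cst_continuous.
split=> [x _|v]; first exact: differentiable_cst.
have -> : 'D_v (fun=> a) = (fun=> 0) :> (E -> F).
  by apply/funext => x; exact: derive_cst.
exact: IH.
Qed.

Lemma CkD F k U (f g : E -> F) : open U -> Ck k U f -> Ck k U g ->
  Ck k U (fun z => f z + g z).
Proof.
move=> oU; elim: k f g => [|k IH] f g.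
  by move=> cf cg x Ux; apply: cvgD; [exact: cf|exact: cg].
move=> [df Df] [dg Dg]; split=> [x Ux|v].
  by apply: differentiableD; [exact: df|exact: dg].
apply: Ck_ext (IH _ _ (Df v) (Dg v)) => // x Ux.
by rewrite deriveD //; apply: diff_derivable; [exact: df|exact: dg].
Qed.

Lemma CkZ F k U (a : E -> R^o) (f : E -> F) : open U -> Ck k U a -> Ck k U f ->
  Ck k U (fun z => a z *: f z).
Proof.
move=> oU; elim: k a f => [|k IH] a f.
  by move=> ca cf x Ux; apply: cvgZ; [exact: ca|exact: cf].
move=> aC fC; have [aC' fC'] := (CkW aC, CkW fC).
case: aC fC => [da Da] [df Df].
have D x : U x -> differentiable (fun z => a z *: f z) x.
  by move=> Ux; have [] := diff_scale (da x Ux) (df x Ux).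
split=> // v.
apply: Ck_ext (CkD oU (IH _ _ aC' (Df v)) (IH _ _ (Da v) fC')) => // x Ux.
rewrite [RHS]deriveE; last exact: D.
have [_ ->] := diff_scale (da x Ux) (df x Ux).
by rewrite !deriveE//; [exact: da|exact: df].
Qed.

Lemma Ck_lin F G k U (L : {linear F -> G}) (f : E -> F) : continuous L ->
  open U -> Ck k U f -> Ck k U (fun z => L (f z)).
Proof.
move=> cL oU; elim: k f => [|k IH] f.
  by move=> cf x Ux; apply: continuous_comp; [exact: cf|exact: cL].
move=> [df Df]; have dL y : differentiable L y by exact: linear_differentiable.
have D x : U x -> differentiable (L \o f) x.
  by move=> Ux; apply: differentiable_comp => //; exact: df.
split=> // v; apply: Ck_ext (IH _ (Df v)) => // x Ux.
rewrite [RHS](deriveE _ (D x Ux)) diff_comp//; last exact: df.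
by rewrite /= diff_lin// deriveE//; exact: df.
Qed.

Lemma Ck_sum F k U (I : Type) (r : seq I) (f : I -> E -> F) : open U ->
  (forall i, Ck k U (f i)) -> Ck k U (fun z => \sum_(i <- r) f i z).
Proof.
move=> oU fC; elim: r => [|i r IH].
  by apply: Ck_ext (Ck_cst k U (0 : F)) => // x _; rewrite big_nil.
by apply: Ck_ext (CkD oU (fC i) IH) => // x _; rewrite big_cons.
Qed.

(** The derivative of [r^(-1/2)] is [-1/2] times its own cube, a polynomial in the function itself,
    so the induction on [k] closes. This is what makes the normalization of fields smooth. *)
Lemma Ck_invsqrt k U (s : E -> R^o) : open U -> (forall x, U x -> 0 < s x) ->
  Ck k U s -> Ck k U (fun z => (Num.sqrt (s z))^-1 : R^o).
Proof.
move=> oU s0; have der (r : R^o) : 0 < r ->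
    is_derive r 1 ((fun r => (Num.sqrt r)^-1) : R^o -> R^o)
      (- 2^-1 * (Num.sqrt r)^-1 ^+ 3).
  move=> r0; have sr0 : Num.sqrt r != 0 by rewrite gt_eqF// sqrtr_gt0.
  have dr := is_derive1_sqrt r0.
  have dV := @is_deriveV _ Num.sqrt r _ 1 sr0 dr.
  have -> : - 2^-1 * (Num.sqrt r)^-1 ^+ 3 = - (Num.sqrt r)^-2 *: (2 * Num.sqrt r)^-1.
    rewrite /GRing.scale /= !mulNr; congr (- _).
    by rewrite -exprVn invfM [RHS]mulrCA -exprSr.
  exact dV.
elim: k s s0 => [|k IH] s s0.
  move=> cs x Ux; apply: (@continuous_comp _ _ _ s (fun r : R => (Num.sqrt r)^-1)).
    exact: cs.
  apply: continuousV; last exact: sqrt_continuous.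
  by rewrite gt_eqF// sqrtr_gt0 s0.
move=> sC; have sC' := CkW sC; have {}IH := IH _ s0 sC'; case: sC => [ds Ds].
set f := fun r : R^o => (Num.sqrt r)^-1 : R^o.
have df x : U x -> differentiable f (s x).
  by move=> Ux; have [/derivable1_diffP] := der _ (s0 x Ux).
have D x : U x -> differentiable (f \o s) x.
  by move=> Ux; apply: differentiable_comp; [exact: ds|exact (df x Ux)].
split=> // v.
have := CkZ oU (CkZ oU (Ck_cst k U (- 2^-1 : R^o)) (CkZ oU IH (CkZ oU IH IH)))
  (Ds v).
apply: Ck_ext => // x Ux; have dr := der _ (s0 x Ux).
rewrite [RHS](deriveE _ (D x Ux)) diff_comp//; [|exact: ds|exact: df].
have d1 : 'd f (s x) 1 = - 2^-1 * (Num.sqrt (s x))^-1 ^+ 3 :> R^o.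
  by rewrite -(deriveE _ (df x Ux)); exact: derive_val.
have dZ u : 'd f (s x) u = u *: 'd f (s x) 1.
  by rewrite -linearZ /= /GRing.scale /= mulr1.
rewrite (deriveE _ (ds x Ux)) /= dZ d1 /GRing.scale /=.
by rewrite !exprS expr0 mulr1 mulrC.
Qed.

End Ck.

Lemma lin_funP (R : realType) (U V : lmodType R) (f : U -> V) :
  (forall (r : R) a u, f (r *: a + u) = r *: f a + f u) ->
  (forall a, f (- a) = - f a) /\ (forall a u, f (a + u) = f a + f u).
Proof.
move=> fl; have fD a u : f (a + u) = f a + f u by have := fl 1 a u; rewrite !scale1r.
split=> // a; apply/eqP; rewrite -addr_eq0 -fD addNr.
by have := fD 0 0; rewrite addr0 => /eqP; rewrite -subr_eq0 opprD addrA subrr add0r oppr_eq0.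
Qed.

Section RowVectors.
Context {R : realType}.
Implicit Types (E F : normedModType R) (n k : nat).

Lemma diff_sum E F (I : Type) (r : seq I) (f : I -> E -> F) x :
  (forall i, differentiable (f i) x) ->
  differentiable (fun z => \sum_(i <- r) f i z) x /\
  forall u, 'd (fun z => \sum_(i <- r) f i z) x u = \sum_(i <- r) 'd (f i) x u.
Proof.
move=> df; elim: r => [|i r [dr er]].
  have -> : (fun z => \sum_(i <- [::]) f i z) = cst 0.
    by apply/funext => z; rewrite big_nil.
  by split=> [|u]; [exact: differentiable_cst|rewrite diff_cst big_nil].
have -> : (fun z => \sum_(j <- i :: r) f j z) =
    f i + (fun z => \sum_(j <- r) f j z).
  by apply/funext => z; rewrite big_cons.
split=> [|u]; first exact: differentiableD.
have e := diffD (df i) dr.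
by rewrite e big_cons -er.
Qed.

Lemma linear_sumE n (V : lmodType R) (L : 'rV[R]_n -> V) (w : 'rV[R]_n) :
  (forall a u v, L (a *: u + v) = a *: L u + L v) ->
  L w = \sum_j w 0 j *: L (delta_mx 0 j).
Proof.
move=> lL; pose M := GRing.isLinear.Build _ _ _ _ L lL.
pose L' : {linear _ -> _} := HB.pack L M.
rewrite [in LHS](row_sum_delta w) -[L]/(L' : _ -> _) linear_sum.
by apply: eq_bigr => j _; rewrite linearZ.
Qed.

Lemma diff_coord E n (f : E -> 'rV[R]_n) j x : differentiable f x ->
  differentiable (fun z => f z 0 j : R^o) x /\
  forall u, 'd (fun z => f z 0 j : R^o) x u = 'd f x u 0 j.
Proof.
move=> df; have lC : linear (fun w : 'rV[R]_n => w 0 j : R^o).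
  by move=> a u v; rewrite !mxE.
pose M := GRing.isLinear.Build _ _ _ _ _ lC.
pose L : {linear 'rV[R]_n -> R^o} := HB.pack (fun w : 'rV[R]_n => w 0 j : R^o) M.
have cL : continuous L by exact: coord_continuous.
have dL : differentiable L (f x) by exact: linear_differentiable.
rewrite -[fun z => _]/(L \o f); split=> [|u]; first exact: differentiable_comp.
have eL : 'd L (f x) = L :> (_ -> _) by exact: diff_lin.
by rewrite (diff_comp df dL) -[LHS]/('d L (f x) ('d f x u)) eL.
Qed.

(* Product rule for a field of linear maps [L], differentiated at a fixed vector. *)
Lemma diff_family E (V F : normedModType R) n (L : V -> 'rV[R]_n -> F)
    (f : E -> V) (w : E -> 'rV[R]_n) x :
  (forall y a u v, L y (a *: u + v) = a *: L y u + L y v) ->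
  (forall v, differentiable (L^~ v) (f x)) ->
  differentiable f x -> differentiable w x ->
  differentiable (fun z => L (f z) (w z)) x /\
  forall u, 'd (fun z => L (f z) (w z)) x u =
    'd (L^~ (w x)) (f x) ('d f x u) + L (f x) ('d w x u).
Proof.
move=> lL dL df dw.
have dc j := diff_coord j dw.
have dLf j : differentiable (fun z => L (f z) (delta_mx 0 j)) x.
  exact: (differentiable_comp df (dL (delta_mx 0 j))).
have dt j := diff_scale (dc j).1 (dLf j).
have [ds es] := diff_sum (index_enum 'I_n) (fun j => (dt j).1).
have -> : (fun z => L (f z) (w z)) =
    (fun z => \sum_j (w z 0 j : R^o) *: L (f z) (delta_mx 0 j)).
  by apply/funext => z; apply: linear_sumE => a u v; exact: lL.
split=> // u; rewrite es.
have -> : L^~ (w x) = (fun y => \sum_j (w x 0 j : R^o) *: L y (delta_mx 0 j)).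
  by apply/funext => z; apply: linear_sumE => a u' v; exact: lL.
have dk j := diff_scale (differentiable_cst (w x 0 j : R^o) (f x))
  (dL (delta_mx 0 j)).
have [_ ->] := diff_sum (index_enum 'I_n) (fun j => (dk j).1).
rewrite [L (f x) _](linear_sumE _ (lL (f x))) -big_split /=.
apply: eq_bigr => j _; rewrite (dt j).2 (dk j).2 (dc j).2; congr (_ + _).
rewrite diff_cst scale0r addr0; congr (_ *: _).
by rewrite -[fun z => L (f z) _]/((L^~ (delta_mx 0 j)) \o f) diff_comp.
Qed.

Lemma Ck_coord E n k (U : set E) (f : E -> 'rV[R]_n) j : open U -> Ck k U f ->
  Ck k U (fun z => f z 0 j : R^o).
Proof.
move=> oU fC; have lC : linear (fun w : 'rV[R]_n => w 0 j : R^o).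
  by move=> a u v; rewrite !mxE.
pose M := GRing.isLinear.Build _ _ _ _ _ lC.
pose L : {linear 'rV[R]_n -> R^o} := HB.pack (fun w : 'rV[R]_n => w 0 j : R^o) M.
by apply: (@Ck_lin _ _ _ _ _ _ L) => //; exact: coord_continuous.
Qed.

(** [Ck] is phrased with fixed directions, whereas the chain rule differentiates [g] in the moving
    direction ['D_v f x]. Expanding that direction in the standard basis gives a finite sum of
    products of [Ck] functions, which is why the middle space consists of row vectors. *)
Lemma Ck_comp E F n k (U : set E) (V : set 'rV[R]_n) (f : E -> 'rV[R]_n)
    (g : 'rV[R]_n -> F) : open U -> (forall x, U x -> V (f x)) ->
  Ck k U f -> Ck k V g -> Ck k U (fun z => g (f z)).
Proof.
move=> oU fV; elim: k g => [|k IH] g.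
  move=> cf cg x Ux; apply: continuous_comp; first exact: cf.
  by apply: cg; exact: fV.
move=> fC; have fC' := CkW fC; case: fC => [df Df] [dg Dg].
have D x : U x -> differentiable (g \o f) x.
  by move=> Ux; apply: differentiable_comp; [exact: df|apply: dg; exact: fV].
split=> // v.
have := Ck_sum (index_enum 'I_n) oU
  (fun j => CkZ oU (Ck_coord j oU (Df v)) (IH _ fC' (Dg (delta_mx 0 j)))).
apply: Ck_ext => // x Ux.
have dgf := dg _ (fV x Ux).
rewrite [RHS](deriveE _ (D x Ux)) (diff_comp (df x Ux) dgf) /=.
rewrite -(deriveE _ (df x Ux)).
rewrite [in RHS](row_sum_delta ('D_v f x)) linear_sum.
apply: eq_bigr => j _; rewrite linearZ /=; congr (_ *: _).
by rewrite deriveE.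
Qed.

End RowVectors.

(** * Smoothness near a point *)

Section SmoothAt.
Context {R : realType} {E : normedModType R}.
Implicit Types (F : normedModType R) (x : E).

Lemma smooth_at_diff F (f : E -> F) x : smooth_at f x -> differentiable f x.
Proof. by move=> [U [oU Ux /(_ 1%N)[]]] /(_ x Ux). Qed.

Lemma near_smooth_diff F (f : E -> F) x : smooth_at f x ->
  \forall z \near x, differentiable f z.
Proof.
move=> [U [oU Ux /(_ 1%N)[df _]]].
by apply: filterS (open_nbhs_nbhs (conj oU Ux)).
Qed.

Lemma smooth_at_cst F (a : F) x : smooth_at (fun=> a) x.
Proof. by exists setT; split=> //; [exact: openT|move=> k; exact: Ck_cst]. Qed.

Lemma smooth_at_ext F (f g : E -> F) x : (\forall z \near x, f z = g z) ->
  smooth_at f x -> smooth_at g x.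
Proof.
move=> fg [U [oU Ux fC]]; exists (U `&` [set z | f z = g z]°).
have oI := open_interior [set z | f z = g z].
split; [exact: openI|by split|move=> k].
have := Ck_sub (@subIsetl _ U ([set z | f z = g z]°)) (fC k).
apply: Ck_ext; first exact: openI.
by move=> z [_ /interior_subset].
Qed.

Lemma smooth_at_eq F (f g : E -> F) x :
  (forall z, f z = g z) -> smooth_at f x -> smooth_at g x.
Proof. by move=> /funext ->. Qed.

Lemma smooth_at_id x : smooth_at (fun z : E => z) x.
Proof.
exists setT; split=> //; first exact: openT.
move=> [|k] /=; first by move=> y _; exact: cvg_id.
split=> [y _|v]; first exact: ex_diff.
have -> : 'D_v (fun z : E => z) = (fun=> v).
  by apply/funext => y; exact: derive_id.
exact: Ck_cst.
Qed.

Lemma smooth_at_derive F (f : E -> F) x v :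
  smooth_at f x -> smooth_at ('D_v f) x /\ smooth_at (fun z => 'd f z v) x.
Proof.
move=> sf; have sD : smooth_at ('D_v f) x.
  by move: sf => [U [oU Ux fC]]; exists U; split=> // k; exact: (fC k.+1).2.
split=> //; apply: smooth_at_ext sD.
by apply: filterS (near_smooth_diff sf) => z df; rewrite deriveE.
Qed.

Lemma smooth_atD F (f g : E -> F) x : smooth_at f x -> smooth_at g x ->
  smooth_at (fun z => f z + g z) x.
Proof.
move=> [U [oU Ux fC]] [V [oV Vx gC]]; exists (U `&` V).
split; [exact: openI|by split|move=> k].
apply: CkD; [exact: openI|exact: Ck_sub (fC k)|exact: Ck_sub (gC k)].
Qed.

Lemma smooth_atZ F (a : E -> R^o) (f : E -> F) x : smooth_at a x ->
  smooth_at f x -> smooth_at (fun z => a z *: f z) x.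
Proof.
move=> [U [oU Ux fC]] [V [oV Vx gC]]; exists (U `&` V).
split; [exact: openI|by split|move=> k].
apply: CkZ; [exact: openI|exact: Ck_sub (fC k)|exact: Ck_sub (gC k)].
Qed.

Lemma smooth_at_sum F (I : Type) (r : seq I) (f : I -> E -> F) x :
  (forall i, smooth_at (f i) x) -> smooth_at (fun z => \sum_(i <- r) f i z) x.
Proof.
move=> fC; elim: r => [|i r IH].
  by apply: smooth_at_ext (smooth_at_cst 0 x); near=> z; rewrite big_nil.
apply: smooth_at_ext (smooth_atD (fC i) IH).
by near=> z; rewrite big_cons.
Unshelve. all: by end_near. Qed.

Lemma smooth_at_coord n (f : E -> 'rV[R]_n) j x : smooth_at f x ->
  smooth_at (fun z => f z 0 j : R^o) x.
Proof.
by move=> [U [oU Ux fC]]; exists U; split=> // k; exact: Ck_coord.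
Qed.

Lemma smooth_at_comp F n (f : E -> 'rV[R]_n) (g : 'rV[R]_n -> F) x :
  smooth_at f x -> smooth_at g (f x) -> smooth_at (fun z => g (f z)) x.
Proof.
move=> fS; have df := smooth_at_diff fS; case: fS => U [oU Ux fC] [V [oV Vx gC]].
have nV : \forall z \near x, V (f z).
  have cf : f z @[z --> x] --> f x by exact: differentiable_continuous.
  by apply: (cf V); exact: open_nbhs_nbhs.
exists (U `&` [set z | V (f z)]°).
have oI := open_interior [set z | V (f z)].
split; [exact: openI|by split|move=> k].
apply: Ck_comp (Ck_sub (@subIsetl _ _ _) (fC k)) (gC k); first exact: openI.
by move=> z [_ /interior_subset].
Qed.

Lemma smooth_at_invsqrt (s : E -> R^o) x : 0 < s x -> smooth_at s x ->
  smooth_at (fun z => (Num.sqrt (s z))^-1 : R^o) x.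
Proof.
move=> s0 sS; have ds := smooth_at_diff sS; case: sS => U [oU Ux sC].
have nV : \forall z \near x, 0 < s z.
  have cs : s z @[z --> x] --> s x by exact: differentiable_continuous.
  by apply: (cs [set r | 0 < r]); apply: open_nbhs_nbhs; split.
exists (U `&` [set z | 0 < s z]°).
have oI := open_interior [set z | 0 < s z].
split; [exact: openI|by split|move=> k].
apply: Ck_invsqrt (Ck_sub (@subIsetl _ _ _) (sC k)); first exact: openI.
by move=> z [_ /interior_subset].
Qed.

Lemma smooth_at_family F (m n : nat) (L : 'rV[R]_m -> 'rV[R]_n -> F)
    (f : E -> 'rV[R]_m) (w : E -> 'rV[R]_n) x :
  (forall y a u v, L y (a *: u + v) = a *: L y u + L y v) ->
  (forall v, smooth_at (L^~ v) (f x)) ->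
  smooth_at f x -> smooth_at w x -> smooth_at (fun z => L (f z) (w z)) x.
Proof.
move=> lL sL sf sw.
apply: smooth_at_ext (smooth_at_sum (index_enum 'I_n) (fun j => smooth_atZ
  (smooth_at_coord j sw) (smooth_at_comp sf (sL (delta_mx 0 j))))).
by near=> z; rewrite [RHS](linear_sumE _ (lL (f z))).
Unshelve. all: by end_near. Qed.

End SmoothAt.

(** * Schwarz's theorem on mixed derivatives *)

Section SymmetryOfSecondDerivatives.
Context {R : realType} {E : normedModType R}.
Implicit Types (f : E -> R^o) (U : set E) (x y u v : E).

Lemma is_derive_line f u y (s : R) : differentiable f (s *: u + y) ->
  is_derive s 1 (fun r : R => f (r *: u + y)) ('D_u f (s *: u + y)).
Proof.
move=> df; pose l (r : R) := r *: u + y.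
have dl : is_diff s l (fun k => k *: u).
  by apply: is_diff_eq; apply/funext => k; rewrite !fctE addr0.
have dfl : differentiable (f \o l) s by apply: differentiable_comp => //.
apply: DeriveDef; first exact: diff_derivable.
rewrite (deriveE _ df) [LHS](deriveE _ dfl).
have -> : 'd (f \o l) s 1 = 'd f (l s) ('d l s 1).
  by rewrite (diff_comp (@ex_diff _ _ _ _ _ _ _ dl) df).
by rewrite [in LHS](@diff_val _ _ _ _ _ _ _ dl) scale1r.
Qed.

(** The mean value theorem is used twice: along [u] for the difference of [f] between two parallel
    sides, then along [v] for ['D_u f]. Exchanging [u] and [v] leaves the second difference
    unchanged. *)
Lemma mixed_difference f U x u v (h : R) : 0 < h -> Ck 2 U f ->
  (forall s t : R, 0 <= s <= h -> 0 <= t <= h -> U (s *: u + t *: v + x)) ->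
  exists s t : R, [/\ 0 <= s <= h, 0 <= t <= h &
    (f (h *: u + h *: v + x) : R) - (f (h *: u + x) : R)
        - ((f (h *: v + x) : R) - (f x : R))
      = ('D_v ('D_u f) (s *: u + t *: v + x) : R) * h * h].
Proof.
move=> h0 [df Df] hU; have [dDf _] := Df u.
have hh : 0 <= h <= h by rewrite lexx ltW.
have h00 : 0 <= (0 : R) <= h by rewrite lexx ltW.
have itv (r : R) : r \in `]0, h[%R -> 0 <= r <= h.
  by rewrite in_itv => /andP[/ltW -> /ltW ->].
have itv' (r : R) : r \in `[0, h]%R -> 0 <= r <= h by rewrite in_itv.
pose g (r : R) : R := f (r *: u + (h *: v + x)) - f (r *: u + x).
have dg (r : R) : 0 <= r <= h ->
    is_derive r 1 g ('D_u f (r *: u + (h *: v + x)) - 'D_u f (r *: u + x)).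
  move=> r0; apply: is_deriveB; apply: is_derive_line; apply: df.
    by rewrite addrA; exact: hU.
  by have := hU r 0 r0 h00; rewrite scale0r addr0.
have cg : {within `[0, h], continuous g}.
  by apply: derivable_within_continuous => r /itv'/dg [].
have [s /itv s0 es] := MVT h0 (fun r rh => dg r (itv r rh)) cg.
pose k (r : R) : R := 'D_u f (r *: v + (s *: u + x)).
have dk (r : R) : 0 <= r <= h ->
    is_derive r 1 k ('D_v ('D_u f) (r *: v + (s *: u + x))).
  move=> r0; apply: is_derive_line; apply: dDf.
  by rewrite addrCA addrA; exact: hU.
have ck : {within `[0, h], continuous k}.
  by apply: derivable_within_continuous => r /itv'/dk [].
have [t /itv t0 et] := MVT h0 (fun r rh => dk r (itv r rh)) ck.
exists s, t; split=> //.
move: es et; rewrite /g /k !scale0r !add0r subr0 => es et.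
rewrite -(addrA (h *: u)) es; congr (_ * _).
have -> : s *: u + t *: v + x = t *: v + (s *: u + x) by rewrite addrCA addrA.
by rewrite -et (addrCA (s *: u)).
Qed.

Lemma no_midpoint (a b c : R) :
  `|a - c| < `|a - b| / 2 -> `|b - c| < `|a - b| / 2 -> False.
Proof.
move=> ac bc; have := ler_distD c a b; rewrite (distrC c b) => h.
suff : `|a - b| < `|a - b| by rewrite ltxx.
by rewrite [ltRHS]splitr (le_lt_trans h)// ltrD.
Qed.

(* At all scales, a mixed second difference is a value of either iterated
   derivative near [x]. *)
Lemma derive_sym f U x u v : open U -> U x -> Ck 2 U f ->
  'D_u ('D_v f) x = 'D_v ('D_u f) x.
Proof.
move=> oU Ux fC; apply/eqP/negPn/negP => ne; have [_ Df] := fC.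
set A := 'D_u ('D_v f) in ne *; set B := 'D_v ('D_u f) in ne *.
have cA : A z @[z --> x] --> A x := (Df v).2 u x Ux.
have cB : B z @[z --> x] --> B x := (Df u).2 v x Ux.
pose e := `|A x - B x| / 2.
have e0 : 0 < e by rewrite divr_gt0// normr_gt0 subr_eq0.
have /nbhs_ballP[d /= d0 dW] : \forall y \near x,
    [/\ U y, `|A x - A y| < e & `|B x - B y| < e].
  have nU : \forall y \near x, U y by exact: open_nbhs_nbhs.
  have nA : \forall y \near x, `|A x - A y| < e by move/cvgrPdist_lt: cA => /(_ e e0).
  have nB : \forall y \near x, `|B x - B y| < e by move/cvgrPdist_lt: cB => /(_ e e0).
  by apply: filterS3 nU nA nB => y *; split.
(* With [h = d / c] the parallelogram of side [h] stays in the ball of radius [d]. The added 1 keeps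
   [c] positive when [u] and [v] vanish and makes the bound strict. *)
pose c := `|u| + `|v| + 1.
have c0 : 0 < c by rewrite ltr_wpDl// addr_ge0.
pose h := d / c; have h0 : 0 < h by rewrite divr_gt0.
have hW (s t : R) : 0 <= s <= h -> 0 <= t <= h -> ball x d (s *: u + t *: v + x).
  move=> /andP[s0 sh] /andP[t0 th].
  rewrite -ball_normE /= opprD addrCA subrr addr0 normrN.
  apply: (@le_lt_trans _ _ (h * (`|u| + `|v|))).
    rewrite (le_trans (ler_normD _ _))// !normrZ mulrDr.
    by rewrite !ger0_norm// lerD// ler_wpM2r.
  by rewrite /h -mulrA gtr_pMr// mulrC ltr_pdivrMr// mul1r /c ltrDl.
have hU s t : 0 <= s <= h -> 0 <= t <= h -> U (s *: u + t *: v + x).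
  by move=> s0 t0; have [] := dW _ (hW s t s0 t0).
have hU' s t : 0 <= s <= h -> 0 <= t <= h -> U (s *: v + t *: u + x).
  by move=> s0 t0; rewrite (addrC (s *: v)); exact: hU.
have [s [t [s0 t0 eB]]] := mixed_difference h0 fC hU.
have [s' [t' [s'0 t'0 eA]]] := mixed_difference h0 fC hU'.
have eAB : A (s' *: v + t' *: u + x) = B (s *: u + t *: v + x).
  have h1 : h != 0 by rewrite gt_eqF.
  have {}eA : _ = (A (s' *: v + t' *: u + x) : R) * h * h := eA.
  have {}eB : _ = (B (s *: u + t *: v + x) : R) * h * h := eB.
  move: (A _) (B _) eA eB => a a'; rewrite (addrC (h *: v)).
  move: (f _) (f (h *: u + x)) (f _) (f x) => p1 p2 p3 p4 eA eB.
  have e2 : (a : R) * h * h = (a' : R) * h * h.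
    by rewrite -[LHS]eA -[RHS]eB; ring.
  by have := mulIf h1 (mulIf h1 e2).
have [_ _ hB] := dW _ (hW s t s0 t0).
have [_ hA _] := dW _ (hW t' s' t'0 s'0).
rewrite (addrC (t' *: u)) eAB in hA.
exact (no_midpoint hA hB).
Qed.

End SymmetryOfSecondDerivatives.

(** The mean value theorem is specific to real values, so the vector case is reduced to
    coordinates. *)
Lemma derive_sym_rV (R : realType) (E : normedModType R) n (f : E -> 'rV[R]_n)
    (U : set E) x u v : open U -> U x -> Ck 2 U f ->
  'D_u ('D_v f) x = 'D_v ('D_u f) x.
Proof.
move=> oU Ux fC; have [df Df] := fC.
have nE w w' j : ('D_w' ('D_w f) x) 0 j = 'D_w' ('D_w (fun z => f z 0 j : R^o)) x.
  have [dDf _] := Df w; have [dc ec] := diff_coord j (dDf x Ux).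
  rewrite (deriveE _ (dDf x Ux)) -ec -deriveE//; apply: near_eq_derive.
  near=> z; have Uz : U z by near: z; exact: open_nbhs_nbhs.
  have [dz ez] := diff_coord j (df z Uz).
  by rewrite (deriveE _ (df z Uz)) (deriveE _ dz) ez.
apply/rowP => j; have e := derive_sym u v oU Ux (Ck_coord j oU fC).
exact (etrans (nE v u j) (etrans e (esym (nE u v j)))).
Unshelve. all: by end_near. Qed.

(** Replaces the recursion of Gram-Schmidt: bases and frames are obtained as orthonormal systems of
    maximal size. *)
Lemma ex_max_nat (P : nat -> Prop) n : P 0%N -> (forall k, P k -> (k <= n)%N) ->
  exists k, P k /\ ~ P k.+1.
Proof.
move=> P0 Pn.
have exP : exists k, `[< P k >] by exists 0%N; exact/asboolP.
have ubP k : `[< P k >] -> (k <= n)%N by move=> /asboolP; exact: Pn.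
have [k /asboolP Pk maxk] := ex_maxnP exP ubP.
by exists k; split=> // /asboolP/maxk; rewrite ltnn.
Qed.

(** * Orthonormal families *)

Definition family_rcons T k (X : 'I_k -> T) (N : T) (i : 'I_k.+1) : T :=
  oapp X N (unlift ord_max i).

Section InnerProduct.
Context {R : realType} {n : nat}.
Implicit Types (b : 'rV[R]_n -> 'rV[R]_n -> R) (S : set 'rV[R]_n) (u v w : 'rV[R]_n).

Definition inner_product b : Prop :=
  [/\ forall u (a : R) v w, b u (a *: v + w) = a * b u v + b u w,
      forall v w, b v w = b w v
    & forall v, v != 0 -> 0 < b v v].

Definition lin_subspace S : Prop :=
  S 0 /\ forall (a : R) u v, S u -> S v -> S (a *: u + v).

Definition ortho_family b (I : finType) (X : I -> 'rV[R]_n) : Prop :=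
  forall i j, b (X i) (X j) = (i == j)%:R.

Definition ortho_expand b (I : finType) (X : I -> 'rV[R]_n) v := \sum_i b v (X i) *: X i.

Lemma subspaceT : lin_subspace setT. Proof. by []. Qed.

Section Subspace.
Variable S : set 'rV[R]_n.
Hypothesis hS : lin_subspace S.

Lemma subspaceZ (a : R) u : S u -> S (a *: u).
Proof. by move=> Su; rewrite -[_ *: _]addr0; apply: hS.2 => //; exact: hS.1. Qed.

Lemma subspaceD u v : S u -> S v -> S (u + v).
Proof. by move=> Su Sv; rewrite -[u]scale1r; exact: hS.2. Qed.

Lemma subspaceB u v : S u -> S v -> S (u - v).
Proof. by move=> Su Sv; rewrite -scaleN1r addrC; exact: hS.2. Qed.

Lemma subspace_sum (I : Type) (r : seq I) (P : pred I) (X : I -> 'rV[R]_n) :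
  (forall i, P i -> S (X i)) -> S (\sum_(i <- r | P i) X i).
Proof.
by move=> SX; elim/big_ind: _ => //; [exact: hS.1|exact: subspaceD].
Qed.

End Subspace.

Section Forms.
Variable b : 'rV[R]_n -> 'rV[R]_n -> R.
Hypothesis hb : inner_product b.

Lemma ip_linr u (a : R) v w : b u (a *: v + w) = a * b u v + b u w.
Proof. by have [h _ _] := hb. Qed.

Lemma ipC u v : b u v = b v u.
Proof. by have [_ h _] := hb. Qed.

Lemma ip0r u : b u 0 = 0.
Proof.
have := ip_linr u 1 0 0; rewrite scaler0 addr0 mul1r => /eqP.
by rewrite addrC -subr_eq subrr eq_sym => /eqP.
Qed.

Lemma ip0l u : b 0 u = 0. Proof. by rewrite ipC ip0r. Qed.

Lemma ipZr u (a : R) v : b u (a *: v) = a * b u v.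
Proof. by rewrite -[a *: v]addr0 ip_linr ip0r addr0. Qed.

Lemma ipDr u v w : b u (v + w) = b u v + b u w.
Proof. by rewrite -[v]scale1r ip_linr mul1r scale1r. Qed.

Lemma ipZl u (a : R) v : b (a *: u) v = a * b u v.
Proof. by rewrite ipC ipZr ipC. Qed.

Lemma ipDl u v w : b (u + v) w = b u w + b v w.
Proof. by rewrite ipC ipDr !(ipC w). Qed.

Lemma ipBr u v w : b u (v - w) = b u v - b u w.
Proof. by rewrite ipDr -scaleN1r ipZr mulN1r. Qed.

Lemma ipBl u v w : b (u - v) w = b u w - b v w.
Proof. by rewrite ipC ipBr !(ipC w). Qed.

Lemma ip_sumr u (I : Type) (r : seq I) (P : pred I) (X : I -> 'rV[R]_n) :
  b u (\sum_(i <- r | P i) X i) = \sum_(i <- r | P i) b u (X i).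
Proof. by apply: (big_morph (b u)); [exact: ipDr|exact: ip0r]. Qed.

Lemma ip_suml u (I : Type) (r : seq I) (P : pred I) (X : I -> 'rV[R]_n) :
  b (\sum_(i <- r | P i) X i) u = \sum_(i <- r | P i) b (X i) u.
Proof. by rewrite ipC ip_sumr; apply: eq_bigr => i _; rewrite ipC. Qed.

Lemma ip_eq0 v : b v v = 0 -> v = 0.
Proof.
have [_ _ pos] := hb; move=> bv; apply/eqP/negPn/negP => /pos.
by rewrite bv ltxx.
Qed.

Lemma ip_ge0 v : 0 <= b v v.
Proof.
have [_ _ pos] := hb; have [->|/pos/ltW//] := eqVneq v 0.
by rewrite ip0r.
Qed.

Lemma subspace_orth S : lin_subspace (orth b S).
Proof.
split=> [v _|a u v Su Sv w Sw]; first by rewrite ip0l.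
by rewrite ipDl ipZl Su// Sv// mulr0 addr0.
Qed.

(** The difference of two candidates for the projection lies in [S] and is orthogonal to [S], hence
    to itself. *)
Lemma oprojE S a u : lin_subspace S -> S a -> orth b S (u - a) -> oproj b S u = a.
Proof.
move=> hS Sa Oa; rewrite /oproj; case: xgetP => [c _ [Sc Oc]|/(_ a)[]//].
have Sca := subspaceB hS Sc Sa.
have e : b (c - a) (c - a) = b (u - a) (c - a) - b (u - c) (c - a).
  by rewrite -ipBl opprB [u - a + _]addrC subrKA.
by apply/subr0_eq/ip_eq0; rewrite [LHS]e Oa// Oc// subrr.
Qed.

Section Orthonormal.
Context {I : finType}.
Variable X : I -> 'rV[R]_n.
Hypothesis hX : ortho_family b X.

Lemma ip_expand i (a : I -> R) : b (\sum_j a j *: X j) (X i) = a i.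
Proof.
rewrite ip_suml (bigD1 i)//= big1 ?addr0 => [|j ji]; rewrite ipZl hX.
  by rewrite eqxx mulr1.
by rewrite (negbTE ji) mulr0.
Qed.

Lemma expandE v : (exists a : I -> R, v = \sum_j a j *: X j) -> v = ortho_expand b X v.
Proof. by move=> [a ->]; apply: eq_bigr => i _; rewrite ip_expand. Qed.

Lemma ip_sub_expand v i : b (v - ortho_expand b X v) (X i) = 0.
Proof. by rewrite ipBl ip_expand subrr. Qed.

Lemma oproj_expand S v : lin_subspace S -> (forall i, S (X i)) ->
  (forall w, S w -> w = ortho_expand b X w) -> oproj b S v = ortho_expand b X v.
Proof.
move=> hS SX Sp; apply: oprojE => //.
  by apply: subspace_sum => // i _; apply: subspaceZ.
move=> w /Sp ->; rewrite ip_sumr big1// => i _.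
by rewrite ipZr ip_sub_expand mulr0.
Qed.

End Orthonormal.

Lemma orthonormal_free k (X : 'I_k -> 'rV[R]_n) : ortho_family b X ->
  row_free (\matrix_(i < k) X i).
Proof.
move=> hX; apply/inj_row_free => a.
have -> : a *m (\matrix_(i < k) X i) = \sum_j a 0 j *: X j.
  by rewrite mulmx_sum_row; apply: eq_bigr => i _; rewrite rowK.
by move=> a0; apply/rowP => i; rewrite mxE -(ip_expand hX i (a 0)) a0 ip0l.
Qed.

Lemma orthonormal_leq k (X : 'I_k -> 'rV[R]_n) : ortho_family b X -> (k <= n)%N.
Proof. by move=> /orthonormal_free/eqP <-; exact: rank_leq_col. Qed.

Lemma orthonormal_full (X : 'I_n -> 'rV[R]_n) v : ortho_family b X ->
  v = ortho_expand b X v.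
Proof.
move=> hX; apply: expandE => //; have := orthonormal_free hX.
(* For a square matrix, freeness and fullness of the rows both say that the rank is [n], so the free
   family has a left inverse, which provides the coefficients. *)
rewrite -row_leq_rank row_leq_rank -[row_free _]/(\rank _ == n).
rewrite -[_ == n]/(row_full _) => /row_fullP [A A1].
exists (fun j => (v *m A) 0 j); rewrite -[LHS]mulmx1 -A1 mulmxA mulmx_sum_row.
by apply: eq_bigr => i _; rewrite rowK.
Qed.

(** The families need only span each other, and their index types may differ. This covers two frames
    of the horizontal space as well as a full frame compared with a union of a horizontal and a
    vertical one. *)
Lemma trace_indep (V : lmodType R) (B : 'rV[R]_n -> 'rV[R]_n -> V)
    (I J : finType) (X : I -> 'rV[R]_n) (Y : J -> 'rV[R]_n) :
  (forall a u v w, B (a *: u + v) w = a *: B u w + B v w) ->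
  (forall a u v w, B u (a *: v + w) = a *: B u v + B u w) ->
  ortho_family b X -> ortho_family b Y ->
  (forall i, X i = ortho_expand b Y (X i)) -> (forall j, Y j = ortho_expand b X (Y j)) ->
  \sum_i B (X i) (X i) = \sum_j B (Y j) (Y j).
Proof.
move=> Bl Br hX hY XY YX.
have B0l w : B 0 w = 0.
  have /eqP := Bl 1 0 0 w; rewrite scaler0 addr0 scale1r.
  by rewrite addrC -subr_eq subrr eq_sym => /eqP.
have B0r w : B w 0 = 0.
  have /eqP := Br 1 w 0 0; rewrite scaler0 addr0 scale1r.
  by rewrite addrC -subr_eq subrr eq_sym => /eqP.
have Bsl (a : J -> R) w : B (\sum_j a j *: Y j) w = \sum_j a j *: B (Y j) w.
  elim/big_rec2: _ => [|j s t _ <-]; [exact: B0l|exact: Bl].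
have Bsr (a : J -> R) w : B w (\sum_j a j *: Y j) = \sum_j a j *: B w (Y j).
  elim/big_rec2: _ => [|j s t _ <-]; [exact: B0r|exact: Br].
transitivity (\sum_i \sum_j \sum_l (b (X i) (Y j) * b (X i) (Y l)) *: B (Y j) (Y l)).
  apply: eq_bigr => i _; rewrite {1 2}(XY i) Bsl.
  apply: eq_bigr => j _; rewrite Bsr scaler_sumr.
  by apply: eq_bigr => l _; rewrite scalerA.
rewrite exchange_big; apply: eq_bigr => j _; rewrite exchange_big /=.
(* Parseval's identity for [Y j] and [Y l] in the family [X]. *)
have bXY l : \sum_i b (X i) (Y j) * b (X i) (Y l) = (j == l)%:R.
  rewrite -hY [in RHS](YX j) ip_suml; apply: eq_bigr => i _.
  by rewrite ipZl (ipC (Y j)).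
under eq_bigr => l _ do rewrite -scaler_suml bXY.
rewrite (bigD1 j)//= eqxx scale1r big1 ?addr0// => l lj.
by rewrite eq_sym (negbTE lj) scale0r.
Qed.

(** Indexing by a sum type avoids renumbering, and sums over it split by [big_sumType] into the two
    blocks. *)
Definition family_sum (I J : finType) (X : I -> 'rV[R]_n) (Y : J -> 'rV[R]_n)
  (i : I + J) : 'rV[R]_n := match i with inl i => X i | inr j => Y j end.

Lemma family_sum_ortho (I J : finType) (X : I -> 'rV[R]_n) (Y : J -> 'rV[R]_n) :
  ortho_family b X -> ortho_family b Y -> (forall i j, b (X i) (Y j) = 0) ->
  ortho_family b (family_sum X Y).
Proof.
move=> oX oY XY [i|i] [j|j] /=.
- by rewrite oX; congr (_%:R); apply/eqP/eqP => [->//|[]].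
- by rewrite XY.
- by rewrite ipC XY.
- by rewrite oY; congr (_%:R); apply/eqP/eqP => [->//|[]].
Qed.

Lemma family_sum_span (I J : finType) (X : I -> 'rV[R]_n) (Y : J -> 'rV[R]_n) u v :
  u = ortho_expand b X u -> v = ortho_expand b Y v ->
  exists a : I + J -> R, u + v = \sum_i a i *: family_sum X Y i.
Proof.
move=> Xu Yv; exists (fun i => match i with
  inl i => b u (X i) | inr j => b v (Y j) end).
by rewrite big_sumType; exact (f_equal2 +%R Xu Yv).
Qed.

Definition unit_vector v := (Num.sqrt (b v v))^-1 *: v.

Lemma orthonormal_ext k (X : 'I_k -> 'rV[R]_n) w : ortho_family b X -> w != 0 ->
  (forall i, b w (X i) = 0) -> ortho_family b (family_rcons X (unit_vector w)).
Proof.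
move=> hX w0 wX i j; have [_ _ pos] := hb.
rewrite /family_rcons; case: (unliftP ord_max i) => [i' ->|->];
  case: (unliftP ord_max j) => [j' ->|->]; rewrite ?liftK ?unlift_none /=.
- by rewrite hX (inj_eq lift_inj).
- by rewrite eq_sym (negbTE (neq_lift _ _)) ipZr ipC wX mulr0.
- by rewrite (negbTE (neq_lift _ _)) ipZl wX mulr0.
- rewrite eqxx ipZl ipZr mulrA -invfM -expr2 sqr_sqrtr ?ip_ge0// mulVf//.
  by rewrite gt_eqF// pos.
Qed.

(** In a maximal orthonormal system of [S], a vector that is not equal to its expansion would leave
    a nonzero remainder in [S], and normalizing that remainder would enlarge the system. *)
Lemma exists_orthonormal_basis S : lin_subspace S ->
  exists k (X : 'I_k -> 'rV[R]_n),
    [/\ ortho_family b X, forall i, S (X i) & forall v, S v -> v = ortho_expand b X v].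
Proof.
move=> hS.
pose P k := exists X : 'I_k -> 'rV[R]_n, ortho_family b X /\ forall i, S (X i).
have P0 : P 0%N by exists (fun=> 0); split=> -[].
have Pn k : P k -> (k <= n)%N by move=> [X [/orthonormal_leq]].
have [k [[X [hX SX]] nP]] := ex_max_nat P0 Pn.
exists k, X; split=> // v Sv; apply/eqP; rewrite -subr_eq0.
apply/negPn/negP => w0; apply: nP; exists (family_rcons X (unit_vector (v - ortho_expand b X v))).
split; first by apply: orthonormal_ext => // i; exact: ip_sub_expand.
have Sw : S (v - ortho_expand b X v).
  by apply: subspaceB => //; apply: subspace_sum => // i _; apply: subspaceZ.
move=> i; rewrite /family_rcons; case: unliftP => [j _|_] //=.
exact: subspaceZ.
Qed.

End Forms.
End InnerProduct.

(** * Fields and connections in charts *)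

Section Charts.
Context {R : realType} {n : nat} {M : manifold R n}.
Implicit Types (p x a b c : M) (u v w : 'rV[R]_n) (Y Z : M -> 'rV[R]_n).

Lemma chart_dom_nbhs p x : chart_dom p x -> nbhs x (chart_dom p).
Proof. by move=> px; apply: open_nbhs_nbhs; split=> //; exact: chart_dom_open. Qed.

Lemma near_chart_inv p x (A : set M) : chart_dom p x -> (\forall y \near x, A y) ->
  \forall z \near chart p x, A (chart_inv p z).
Proof.
move=> px nA.
have c : chart_inv p z @[z --> chart p x] --> chart_inv p (chart p x).
  by apply: chart_inv_continuous; exists x.
by rewrite chartK// in c; exact: c A nA.
Qed.

Lemma near_chart p x (B : set 'rV[R]_n) : chart_dom p x ->
  (\forall z \near chart p x, B z) -> \forall y \near x, B (chart p y).
Proof. by move=> px nB; exact: (chart_continuous px nB). Qed.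

Lemma near_chart_img p x : chart_dom p x ->
  \forall z \near chart p x, chart_dom p (chart_inv p z) /\ chart p (chart_inv p z) = z.
Proof.
move=> px; have oI : open (chart p @` chart_dom p) by exact: chart_img_open.
have nI : nbhs (chart p x) (chart p @` chart_dom p).
  by apply: open_nbhs_nbhs; split=> //; exists x.
by apply: filterS nI => z [y py <-]; rewrite chartK.
Qed.

Lemma transition_diff a b x : chart_dom a x -> chart_dom b x ->
  differentiable (chart b \o chart_inv a) (chart a x).
Proof.
move=> ax bx; have [+ _] := chart_transition a b 1%N; apply.
by exists x.
Qed.

Lemma tchange_comp a b c x v : chart_dom a x -> chart_dom b x -> chart_dom c x ->
  tchange b c x (tchange a b x v) = tchange a c x v.
Proof.
move=> ax bx cx.
have e : \forall z \near chart a x,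
    (chart c \o chart_inv b) ((chart b \o chart_inv a) z) =
    (chart c \o chart_inv a) z.
  have nb := near_chart_inv ax (chart_dom_nbhs bx).
  by apply: filterS nb => z bz /=; rewrite chartK.
have ebx : (chart b \o chart_inv a) (chart a x) = chart b x by rewrite /= chartK.
exact (esym ((diff_chain ebx (transition_diff ax bx) (transition_diff bx cx) e).2 v)).
Qed.

Lemma tchange_id a x v : chart_dom a x -> tchange a a x v = v.
Proof.
move=> ax; rewrite /tchange.
have e : \forall z \near chart a x, idfun z = (chart a \o chart_inv a) z.
  by apply: filterS (near_chart_img ax) => z [_ /= ->].
have [d ->] := near_eq_diff e (ex_diff (is_diff_def := is_diff_id (chart a x))).
by rewrite diff_val.
Qed.

Lemma tchange_lin a b x (r : R) u v :
  tchange a b x (r *: u + v) = r *: tchange a b x u + tchange a b x v.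
Proof. exact: linearP. Qed.

Lemma tchangeK a b x v : chart_dom a x -> chart_dom b x ->
  tchange b a x (tchange a b x v) = v.
Proof. by move=> ax bx; rewrite tchange_comp// tchange_id. Qed.

Lemma field_coords_center p Y : field_coords Y p (chart p p) = Y p.
Proof.
have pp := chart_dom_center p.
by rewrite /field_coords chartK// tchange_id.
Qed.

Lemma near_field_coords p Y : \forall x \near p,
  Y x = tchange p x x (field_coords Y p (chart p x)).
Proof.
have pp := chart_dom_center p.
apply: filterS (chart_dom_nbhs pp) => x px; rewrite /field_coords chartK//.
by rewrite tchangeK//; exact: chart_dom_center.
Qed.

Lemma near_field_coords_const p w : \forall z \near chart p p,
  field_coords (const_field p w) p z = w.
Proof.
have pp := chart_dom_center p.
apply: filterS (near_chart_img pp) => z [pz _].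
by rewrite /field_coords /const_field tchangeK//; exact: chart_dom_center.
Qed.

Lemma const_field_center p w : const_field p w p = w.
Proof. by rewrite /const_field tchange_id//; exact: chart_dom_center. Qed.

Lemma const_field_smooth p w : field_smooth_at (const_field p w) p.
Proof.
apply: smooth_at_ext (smooth_at_cst w (chart p p)).
by apply: filterS (near_field_coords_const p w) => z ->.
Qed.

Lemma near_field_ext p Y Z : (\forall x \near p, Y x = Z x) ->
  \forall z \near chart p p, field_coords Y p z = field_coords Z p z.
Proof.
move=> /(near_chart_inv (chart_dom_center p)); apply: filterS => z.
by rewrite /field_coords => ->.
Qed.

Lemma field_smooth_ext p Y Z : (\forall x \near p, Y x = Z x) ->
  field_smooth_at Y p -> field_smooth_at Z p.
Proof. by move=> /near_field_ext; exact: smooth_at_ext. Qed.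

Lemma field_smoothD p Y Z : field_smooth_at Y p -> field_smooth_at Z p ->
  field_smooth_at (fun x => Y x + Z x) p.
Proof.
move=> sY sZ; apply: smooth_at_eq (smooth_atD sY sZ) => z.
by rewrite /field_coords /tchange linearD.
Qed.

Lemma field_smoothZ p (f : M -> R) Y : smooth_fun_at f p -> field_smooth_at Y p ->
  field_smooth_at (fun x => f x *: Y x) p.
Proof.
move=> sf sY; apply: smooth_at_eq (smooth_atZ sf sY) => z.
by rewrite /field_coords /tchange linearZ.
Qed.

Lemma field_smooth0 p : field_smooth_at (fun=> 0 : 'rV[R]_n) p.
Proof.
apply: smooth_at_eq (smooth_at_cst 0 (chart p p)) => z.
by rewrite /field_coords /tchange linear0.
Qed.

Lemma field_smooth_sum p (I : Type) (r : seq I) (Y : I -> M -> 'rV[R]_n) :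
  (forall i, field_smooth_at (Y i) p) ->
  field_smooth_at (fun x => \sum_(i <- r) Y i x) p.
Proof.
move=> sY; elim: r => [|i r IH].
  by apply: field_smooth_ext (field_smooth0 p); near=> x; rewrite big_nil.
by apply: field_smooth_ext (field_smoothD (sY i) IH); near=> x; rewrite big_cons.
Unshelve. all: by end_near. Qed.

Lemma smooth_fun_cst p (r : R) : smooth_fun_at (fun=> r) p.
Proof. exact: smooth_at_cst. Qed.

Lemma dfun_ext p (f g : M -> R) v : (\forall x \near p, f x = g x) ->
  smooth_fun_at f p -> dfun f p v = dfun g p v.
Proof.
move=> fg /smooth_at_diff df; rewrite /dfun.
have [_ e] := near_eq_diff (near_chart_inv (chart_dom_center p) fg) df.
exact (esym (congr1 (fun h : _ -> _ => h v) e)).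
Qed.

Lemma dfun_cst p (r : R) v : dfun (fun=> r) p v = 0.
Proof. by rewrite /dfun diff_cst. Qed.

Lemma near_expand p Y : \forall x \near p,
  Y x = \sum_j field_coords Y p (chart p x) 0 j *: const_field p (delta_mx 0 j) x.
Proof.
apply: filterS (near_field_coords p Y) => x ->.
exact: (linear_sumE _ (tchange_lin p x x)).
Qed.

Lemma smooth_field_coord p Y j : field_smooth_at Y p ->
  smooth_fun_at (fun x => field_coords Y p (chart p x) 0 j) p /\
  forall v, dfun (fun x => field_coords Y p (chart p x) 0 j) p v =
    'd (field_coords Y p) (chart p p) v 0 j.
Proof.
move=> sY; have e : \forall z \near chart p p, field_coords Y p z 0 j =
    field_coords Y p (chart p (chart_inv p z)) 0 j.
  by apply: filterS (near_chart_img (chart_dom_center p)) => z [_ ->].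
split; first exact: smooth_at_ext e (smooth_at_coord j sY).
move=> v; have [dc ec] := diff_coord j (smooth_at_diff sY).
have [_ e'] := near_eq_diff (f := fun z => field_coords Y p z 0 j : R^o) e dc.
exact (etrans (congr1 (fun h : _ -> _ => h v) e') (ec v)).
Qed.

End Charts.

(** * Connections and their Christoffel symbols *)

Section Connections.
Context {R : realType} {n : nat} {M : manifold R n}.
Implicit Types (p x : M) (u v w : 'rV[R]_n) (Y Z : M -> 'rV[R]_n).
Variable nabla : conn_op M.
Hypothesis hn : affine_connection nabla.

Lemma conn_scale p v (a : R) Y : field_smooth_at Y p ->
  nabla p v (fun x => a *: Y x) = a *: nabla p v Y.
Proof.
move=> sY; have := conn_leibniz hn v (smooth_fun_cst p a) sY.
by rewrite dfun_cst scale0r add0r.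
Qed.

Lemma conn0 p v : nabla p v (fun=> 0) = 0.
Proof.
have e := conn_scale v 0 (field_smooth0 p); rewrite [RHS]scale0r in e.
by rewrite -[RHS]e; congr (nabla p v); apply/funext => x; rewrite scaler0.
Qed.

Lemma conn_sum p v (I : Type) (r : seq I) (Y : I -> M -> 'rV[R]_n) :
  (forall i, field_smooth_at (Y i) p) ->
  nabla p v (fun x => \sum_(i <- r) Y i x) = \sum_(i <- r) nabla p v (Y i).
Proof.
move=> sY; elim: r => [|i r IH].
  rewrite big_nil -[RHS](conn0 p v); congr (nabla p v).
  by apply/funext => x; rewrite big_nil.
rewrite big_cons -IH -conn_add//; last exact: field_smooth_sum.
by congr (nabla p v); apply/funext => x; rewrite big_cons.
Qed.

Lemma christoffel_linr p v (a : R) u w :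
  christoffel nabla p v (a *: u + w) =
  a *: christoffel nabla p v u + christoffel nabla p v w.
Proof.
have cs := const_field_smooth p.
rewrite /christoffel -conn_scale// -conn_add//.
  by congr (nabla p v); apply/funext => x; exact: tchange_lin.
by apply: field_smoothZ => //; exact: smooth_fun_cst.
Qed.

Lemma christoffel_linl p v (a : R) u w :
  christoffel nabla p (a *: u + w) v =
  a *: christoffel nabla p u v + christoffel nabla p w v.
Proof. by rewrite /christoffel conn_linear_dir//; exact: const_field_smooth. Qed.

(** Near [p] the field is a combination of coordinate fields; locality and the Leibniz rule do the
    rest. This ties the axiomatic connection to the coordinate formula by which [cov_along] is
    defined. *)
Lemma conn_coords p v Y : field_smooth_at Y p ->
  nabla p v Y = 'd (field_coords Y p) (chart p p) v + christoffel nabla p v (Y p).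
Proof.
move=> sY; have sc j := smooth_field_coord j sY.
have st j : field_smooth_at (fun x => field_coords Y p (chart p x) 0 j *:
    const_field p (delta_mx 0 j) x) p.
  by apply: field_smoothZ; [exact: (sc j).1|exact: const_field_smooth].
have -> : nabla p v Y = \sum_j nabla p v (fun x =>
    field_coords Y p (chart p x) 0 j *: const_field p (delta_mx 0 j) x).
  rewrite -conn_sum//; apply: conn_local => //; first exact: field_smooth_sum.
  exact: near_expand.
rewrite [X in X + _]row_sum_delta.
rewrite [X in _ + X](linear_sumE _ (christoffel_linr p v)) -big_split /=.
apply: eq_bigr => j _.
have [scj dcj] := sc j; have cs := const_field_smooth p (delta_mx 0 j : 'rV[R]_n).
rewrite (conn_leibniz hn v scj cs) dcj const_field_center.
by rewrite field_coords_center.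
Qed.

End Connections.

Section LeviCivita.
Context {R : realType} {n : nat} {M : manifold R n}.
Implicit Types (p x : M) (u v w : 'rV[R]_n) (Y Z : M -> 'rV[R]_n).

(** Fields with constant coordinates have zero bracket at [p], so vanishing torsion is exactly this
    symmetry. *)
Lemma christoffel_sym (g : tensor2 M) (nabla : conn_op M) p v w :
  levi_civita g nabla -> christoffel nabla p v w = christoffel nabla p w v.
Proof.
move=> [hn tor _]; have cs := const_field_smooth p.
have := tor p _ _ (cs v) (cs w); rewrite /lie_bracket !const_field_center.
have d0 u t : 'd (field_coords (const_field p u) p) (chart p p) t = 0.
  have e : \forall z \near chart p p, cst u z = field_coords (const_field p u) p z.
    by apply: filterS (near_field_coords_const p u) => z ->.
  have [_ e'] := near_eq_diff e (differentiable_cst u (chart p p)).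
  by rewrite (congr1 (fun h : _ -> _ => h t) e') diff_cst.
move=> e; have e2 := f_equal2 (fun a b => a - b) (d0 w v) (d0 v w).
exact (subr0_eq (etrans e (etrans e2 (subrr 0)))).
Qed.

Lemma metric_inner_product (g : tensor2 M) p : riemannian_metric g ->
  inner_product (g p).
Proof. by move=> [gl gs gp _]; split=> [u a v w|v w|v]; [rewrite !(gs p u)|exact: gs|exact: gp]; exact: gl. Qed.

End LeviCivita.

Section OrthonormalSpan.
Context {R : realType} {n : nat}.
Variable b : 'rV[R]_n -> 'rV[R]_n -> R.
Hypothesis hb : inner_product b.

Lemma orthonormal_span (I : finType) (X : I -> 'rV[R]_n) v : ortho_family b X ->
  #|I| = n -> v = ortho_expand b X v.
Proof.
move=> hX cI; pose Y (i : 'I_#|I|) := X (enum_val i).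
have hY : ortho_family b Y.
  by move=> i j; rewrite /Y hX (inj_eq enum_val_inj).
have -> : ortho_expand b X v = ortho_expand b Y v.
  by rewrite /ortho_expand (reindex _ (onW_bij _ (enum_val_bij I))).
by move: Y hY; rewrite cI => Y hY; exact: orthonormal_full.
Qed.

Lemma orthonormal_card (I : finType) (X : I -> 'rV[R]_n) : ortho_family b X ->
  (#|I| <= n)%N.
Proof.
move=> oX; apply: (orthonormal_leq hb (X := fun i : 'I_#|I| => X (enum_val i))).
by move=> i j; rewrite oX (inj_eq enum_val_inj).
Qed.

Lemma span_card (I : finType) (X : I -> 'rV[R]_n) :
  (forall v, exists a : I -> R, v = \sum_i a i *: X i) -> (n <= #|I|)%N.
Proof.
move=> sX; pose A := \matrix_(i < #|I|) X (enum_val i).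
suff /eqP <- : row_full A by exact: rank_leq_row.
rewrite -sub1mx; apply/row_subP => j.
have [a ->] := sX (row j 1%:M).
apply/submxP; exists (\row_i a (enum_val i)); rewrite mulmx_sum_row.
rewrite (reindex _ (onW_bij _ (enum_val_bij I))).
by apply: eq_bigr => i _; rewrite rowK mxE.
Qed.

End OrthonormalSpan.

(** * Local orthonormal frames *)

Section Frames.
Context {R : realType} {n : nat} {M : manifold R n}.
Implicit Types (p x : M) (v w : 'rV[R]_n) (Y Z W : M -> 'rV[R]_n).
Variable g : tensor2 M.
Hypothesis hg : riemannian_metric g.

Lemma metric_smooth p Y Z : field_smooth_at Y p -> field_smooth_at Z p ->
  smooth_fun_at (fun x => g x (Y x) (Z x)) p.
Proof. by have [_ _ _ h] := hg; exact: h. Qed.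

Lemma smooth_fun_near_pos p (f : M -> R) : smooth_fun_at f p -> 0 < f p ->
  \forall x \near p, 0 < f x.
Proof.
move=> /smooth_at_diff/differentiable_continuous.
have pp := chart_dom_center p.
move=> cf f0.
have {}cf : f (chart_inv p z) @[z --> chart p p] --> f (chart_inv p (chart p p)).
  exact cf.
rewrite chartK// in cf.
have nz : \forall z \near chart p p, 0 < f (chart_inv p z).
  by apply: (cf [set r | 0 < r]); apply: open_nbhs_nbhs; split=> //; exact: open_gt.
apply: filterS2 (chart_dom_nbhs pp) (near_chart pp nz) => x px.
by rewrite chartK.
Qed.

Lemma smooth_fun_invsqrt p (f : M -> R) : smooth_fun_at f p -> 0 < f p ->
  smooth_fun_at (fun x => (Num.sqrt (f x))^-1) p.
Proof.
move=> sf f0; apply: smooth_at_invsqrt sf.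
by rewrite chartK//; exact: chart_dom_center.
Qed.

Lemma expand_smooth p k (X : 'I_k -> M -> 'rV[R]_n) W :
  (forall i, field_smooth_at (X i) p) -> field_smooth_at W p ->
  field_smooth_at (fun x => ortho_expand (g x) (X^~ x) (W x)) p.
Proof.
move=> sX sW; apply: field_smooth_sum => i.
by apply: field_smoothZ => //; exact: metric_smooth.
Qed.

Lemma field_smoothB p Y Z : field_smooth_at Y p -> field_smooth_at Z p ->
  field_smooth_at (fun x => Y x - Z x) p.
Proof.
move=> sY sZ; have -> : (fun x => Y x - Z x) = (fun x => Y x + (-1 : R) *: Z x).
  by apply/funext => x; rewrite scaleN1r.
apply: field_smoothD => //; apply: field_smoothZ => //; exact: smooth_fun_cst.
Qed.

Lemma normalize_smooth p W : field_smooth_at W p -> W p != 0 ->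
  field_smooth_at (fun x => unit_vector (g x) (W x)) p.
Proof.
move=> sW W0; have [_ _ gpos _] := hg.
apply: field_smoothZ => //; apply: smooth_fun_invsqrt; first exact: metric_smooth.
exact: gpos.
Qed.

Lemma near_neq0 p W : field_smooth_at W p -> W p != 0 -> \forall x \near p, W x != 0.
Proof.
move=> sW W0; have [_ _ gpos _] := hg.
apply: filterS (smooth_fun_near_pos (metric_smooth sW sW) (gpos _ _ W0)) => x.
by apply: contraTneq => ->; rewrite (ip0r (metric_inner_product x hg)) ltxx.
Qed.

(* Gram-Schmidt, as the extension of a maximal orthonormal system of fields in [D]. *)
Lemma exists_local_frame (D : M -> set 'rV[R]_n) p :
  (forall x, lin_subspace (D x)) ->
  (forall w, D p w -> exists W,
     [/\ field_smooth_at W p, W p = w & \forall x \near p, D x (W x)]) ->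
  exists k (X : 'I_k -> M -> 'rV[R]_n),
    [/\ forall i, field_smooth_at (X i) p,
        \forall x \near p, ortho_family (g x) (X^~ x) /\ forall i, D x (X i x)
      & forall v, D p v -> v = ortho_expand (g p) (X^~ p) v].
Proof.
move=> hD ext; have ip x := metric_inner_product x hg.
pose P k := exists X : 'I_k -> M -> 'rV[R]_n,
  (forall i, field_smooth_at (X i) p) /\
  \forall x \near p, ortho_family (g x) (X^~ x) /\ forall i, D x (X i x).
have P0 : P 0%N.
  exists (fun=> const_field p 0); split=> [[]//|].
  by near=> x; split=> -[].
have Pn k : P k -> (k <= n)%N.
  by move=> [X [_ /nbhs_singleton[/(orthonormal_leq (ip p))]]].
have [k [[X [sX nX]] nP]] := ex_max_nat P0 Pn.
(* Maximality gives spanning at [p] only, since the remainder must be nonzero at [p] to stay nonzero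
   nearby. Spanning at neighbouring points is left to a dimension count. *)
exists k, X; split=> // v Dv; apply/eqP; rewrite -subr_eq0.
apply/negPn/negP => w0; apply: nP.
have [W [sW Wv nW]] := ext v Dv.
pose V x := W x - ortho_expand (g x) (X^~ x) (W x).
have sV : field_smooth_at V p by apply: field_smoothB => //; exact: expand_smooth.
have V0 : V p != 0 by rewrite /V Wv.
exists (family_rcons X (fun x => unit_vector (g x) (V x))); split.
  move=> i; rewrite /family_rcons; case: unliftP => [j _|_] //=.
  exact: normalize_smooth.
have nV := near_neq0 sV V0.
apply: filterS3 nX nW nV => x [oX DX] DW Vx0.
have DV : D x (V x).
  apply: subspaceB => //; apply: subspace_sum => // i _.
  exact: subspaceZ.
split.
  have -> : (family_rcons X (fun x => unit_vector (g x) (V x)))^~ x =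
      family_rcons (X^~ x) (unit_vector (g x) (V x)).
    by apply/funext => i; rewrite /family_rcons; case: unliftP.
  by apply: orthonormal_ext => // i; exact: ip_sub_expand.
move=> i; rewrite /family_rcons; case: unliftP => [j _|_] //=.
exact: subspaceZ.
Unshelve. all: by end_near. Qed.

Lemma exists_orthonormal_frame p : exists X : 'I_n -> M -> 'rV[R]_n,
  (forall i, field_smooth_at (X i) p) /\
  \forall x \near p, ortho_family (g x) (X^~ x).
Proof.
have [|w _|k [X [sX nX spX]]] := @exists_local_frame (fun=> setT) p.
- by move=> x; exact: subspaceT.
- exists (const_field p w); split; [exact: const_field_smooth| |exact: nearW].
  exact: const_field_center.
have kn : k = n.
  have [oX _] := nbhs_singleton nX.
  apply/eqP; rewrite eqn_leq (orthonormal_leq (metric_inner_product p hg) oX)/=.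
  rewrite -[k in (_ <= k)%N]card_ord; apply: (span_card (X := X^~ p)) => v.
  by exists (fun i => g p v (X i p)); exact: spX.
subst k; exists X; split=> //.
by apply: filterS nX => x [].
Qed.

End Frames.

(** * Sections along a map *)

Section AlongMap.
Context {R : realType} {m q : nat} {P : manifold R m} {Q : manifold R q}.
Variables (nablaQ : conn_op Q) (pi : P -> Q).
Hypothesis hpi : smooth_map pi.
Implicit Types (p x : P) (W : P -> 'rV[R]_q).

Definition map_rep p : 'rV[R]_m -> 'rV[R]_q := chart (pi p) \o pi \o chart_inv p.

(* A section [W] along [pi], in the coordinates given by [chart (pi p)]. *)
Definition sec_coords p W (z : 'rV[R]_m) : 'rV[R]_q :=
  let x := chart_inv p z in tchange (pi x) (pi p) (pi x) (W x).

(** First-order regularity suffices for one covariant derivative, and it is the level at which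
    [alpha_part] of a frame field is controlled. *)
Definition sec_diff W p := differentiable (sec_coords p W) (chart p p).

Lemma map_rep_smooth p : smooth_at (map_rep p) (chart p p).
Proof. by have [_] := hpi p. Qed.

Lemma map_rep_center p : map_rep p (chart p p) = chart (pi p) (pi p).
Proof. by rewrite /map_rep /= chartK//; exact: chart_dom_center. Qed.

Lemma near_map_dom p : \forall x \near p, chart_dom (pi p) (pi x).
Proof.
have [c _] := hpi p; apply: c; apply: chart_dom_nbhs; exact: chart_dom_center.
Qed.

(** [dmap] at [x] refers to the charts centred at [x] and [pi x], which change with [x]. Both sides
    are the differential of the mixed expression [k], so near [p] everything can be read in the two
    fixed charts at [p] and [pi p]. *)
Lemma dmap_chart p : \forall x \near p, forall v,
  tchange (pi x) (pi p) (pi x) (dmap pi x v) =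
  'd (map_rep p) (chart p x) (tchange x p x v).
Proof.
have pp := chart_dom_center p.
have nd := near_chart pp (near_smooth_diff (map_rep_smooth p)).
apply: filterS3 (chart_dom_nbhs pp) (near_map_dom p) nd => x px qx dF v.
have xx := chart_dom_center x; have yy := chart_dom_center (pi x).
pose k := chart (pi p) \o pi \o chart_inv x.
have e1 : \forall z \near chart x x,
    (chart (pi p) \o chart_inv (pi x)) (map_rep x z) = k z.
  apply: filterS (near_chart_inv xx (near_map_dom x)) => z h.
  by rewrite /= chartK.
have e2 : \forall z \near chart x x,
    map_rep p ((chart p \o chart_inv x) z) = k z.
  apply: filterS (near_chart_inv xx (chart_dom_nbhs px)) => z h.
  by rewrite /map_rep /= chartK.
have h1 := diff_chain (map_rep_center x) (smooth_at_diff (map_rep_smooth x))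
  (transition_diff yy qx) e1.
have e0 : (chart p \o chart_inv x) (chart x x) = chart p x by rewrite /= chartK.
have h2 := diff_chain e0 (transition_diff xx px) dF e2.
exact (etrans (esym (h1.2 v)) (h2.2 v)).
Qed.

Lemma dmapE p v : dmap pi p v = 'd (map_rep p) (chart p p) v.
Proof. by []. Qed.

Lemma dmapP p (a : R) u v :
  dmap pi p (a *: u + v) = a *: dmap pi p u + dmap pi p v.
Proof. exact: linearP. Qed.

Lemma sec_coords_center p W : sec_coords p W (chart p p) = W p.
Proof.
rewrite /sec_coords chartK; last exact: chart_dom_center.
by rewrite tchange_id//; exact: chart_dom_center.
Qed.

Lemma near_sec_coords p W : \forall z \near chart p p,
  let x := chart_inv p z in
  [/\ chart_dom (pi p) (pi x), chart_inv (pi p) (map_rep p z) = pi x &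
      W x = tchange (pi p) (pi x) (pi x) (sec_coords p W z)].
Proof.
have pp := chart_dom_center p.
apply: filterS (near_chart_inv pp (near_map_dom p)) => z h /=.
split=> //; first by rewrite /map_rep /= chartK.
by rewrite /sec_coords tchangeK//; exact: chart_dom_center.
Qed.

Lemma pullback_connE p v W : pullback_conn nablaQ pi p v W =
  'd (sec_coords p W) (chart p p) v + christoffel nablaQ (pi p) (dmap pi p v) (W p).
Proof.
rewrite /pullback_conn /cov_along /=.
by rewrite /dmap /sec_coords chartK; last exact: chart_dom_center.
Qed.

Lemma pullback_ext p v W W' : (\forall x \near p, W x = W' x) -> sec_diff W p ->
  sec_diff W' p /\ pullback_conn nablaQ pi p v W = pullback_conn nablaQ pi p v W'.
Proof.
move=> e dW; have e1 : \forall z \near chart p p, sec_coords p W z = sec_coords p W' z.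
  apply: filterS (near_chart_inv (chart_dom_center p) e) => z.
  by rewrite /sec_coords => ->.
have [dW' e2] := near_eq_diff e1 dW; split; first exact dW'.
have eW : W p = W' p := nbhs_singleton e.
have {}e2 := esym (congr1 (fun h : _ -> _ => h v) e2).
rewrite (pullback_connE p v W) (pullback_connE p v W') eW.
exact (congr1 (fun t => t + _) e2).
Qed.

Lemma sec_coords_lin p (a : R) W W' : sec_coords p (fun x => a *: W x + W' x) =
  (fun z => a *: sec_coords p W z + sec_coords p W' z).
Proof. by apply/funext => z; exact: tchange_lin. Qed.

Lemma pullback_lin p v (a : R) W W' : affine_connection nablaQ ->
  sec_diff W p -> sec_diff W' p ->
  sec_diff (fun x => a *: W x + W' x) p /\
  pullback_conn nablaQ pi p v (fun x => a *: W x + W' x) =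
  a *: pullback_conn nablaQ pi p v W + pullback_conn nablaQ pi p v W'.
Proof.
move=> hn dW dW'; have dZ : differentiable (a \*: sec_coords p W) (chart p p).
  exact: differentiableZ.
have dD := differentiableD dZ dW'.
have eD := diffD dZ dW'; have eZ := diffZ a dW.
split; first by rewrite /sec_diff sec_coords_lin.
rewrite !pullback_connE sec_coords_lin (christoffel_linr hn) scalerDr addrACA.
have {}eZ := congr1 (fun h : _ -> _ => h v) eZ.
have {}eD := congr1 (fun h : _ -> _ => h v) eD.
exact (congr1 (fun t => t + _) (etrans eD (congr1 (fun t => t + _) eZ))).
Qed.

Lemma sec_diffZ p (f : P -> R) W :
  differentiable (fun z => f (chart_inv p z) : R^o) (chart p p) ->
  sec_diff W p -> sec_diff (fun x => f x *: W x) p.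
Proof.
move=> df dW; rewrite /sec_diff.
have -> : sec_coords p (fun x => f x *: W x) =
    (fun z => (f (chart_inv p z) : R^o) *: sec_coords p W z).
  by apply/funext => z; rewrite /sec_coords /tchange linearZ.
exact: (diff_scale df dW).1.
Qed.

Lemma sec_diff_sum p (I : Type) (r : seq I) (W : I -> P -> 'rV[R]_q) :
  (forall i, sec_diff (W i) p) -> sec_diff (fun x => \sum_(i <- r) W i x) p.
Proof.
move=> dW; rewrite /sec_diff.
have -> : sec_coords p (fun x => \sum_(i <- r) W i x) =
    (fun z => \sum_(i <- r) sec_coords p (W i) z).
  by apply/funext => z; rewrite /sec_coords /tchange linear_sum.
exact: (diff_sum r dW).1.
Qed.

End AlongMap.

(** * The second fundamental form in coordinates *)

Section Hessian.
Context {R : realType} {m q : nat} {P : manifold R m} {Q : manifold R q}.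
Variables (nablaP : conn_op P) (nablaQ : conn_op Q) (pi : P -> Q).
Hypothesis hpi : smooth_map pi.
Hypotheses (hnP : affine_connection nablaP) (hnQ : affine_connection nablaQ).
Implicit Types (p x : P) (Y : P -> 'rV[R]_m) (u v w : 'rV[R]_m).

Lemma near_sec_coords_push p Y : \forall z \near chart p p,
  'd (map_rep pi p) z (field_coords Y p z) = sec_coords pi p (push pi Y) z.
Proof.
have pp := chart_dom_center p.
apply: filterS2 (near_chart_inv pp (dmap_chart hpi p)) (near_chart_img pp).
by move=> z h [_ e]; have := h (Y (chart_inv p z)); rewrite e => <-.
Qed.

Lemma push_smooth p Y : field_smooth_at Y p ->
  smooth_at (sec_coords pi p (push pi Y)) (chart p p).
Proof.
move=> sY; apply: smooth_at_ext (near_sec_coords_push p Y) _.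
apply: (@smooth_at_family _ _ _ _ _ (fun z w => 'd (map_rep pi p) z w)
  (fun z => z)) => //; last exact: smooth_at_id.
  by move=> z a u v; exact: linearP.
by move=> w; exact: (smooth_at_derive w (map_rep_smooth hpi p)).2.
Qed.

Lemma push_diff p Y : field_smooth_at Y p -> sec_diff pi (push pi Y) p.
Proof. by move=> /push_smooth/smooth_at_diff. Qed.

(** The classical coordinate formula for the second fundamental form. It takes vectors at [p]
    instead of fields, so tensoriality is built in. *)
Definition hess p u w : 'rV[R]_q :=
  'D_u ('D_w (map_rep pi p)) (chart p p)
  + christoffel nablaQ (pi p) (dmap pi p u) (dmap pi p w)
  - dmap pi p (christoffel nablaP p u w).

(** The product rule for [z |-> dF_z (Y z)], with [F] the map in charts, gives a second derivative
    of [F] plus [dF] of the derivative of [Y]. The latter cancels against the same term in the image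
    of [nablaP]. *)
Lemma second_fund_formE p X Y : field_smooth_at Y p ->
  second_fund_form nablaP nablaQ pi p X Y = hess p (X p) (Y p).
Proof.
move=> sY; rewrite /second_fund_form (conn_coords hnP _ sY) pullback_connE.
set u := X p; set c := chart p p.
have sF := map_rep_smooth hpi p.
have sD w : smooth_at (fun z => 'd (map_rep pi p) z w) c.
  exact: (smooth_at_derive w sF).2.
have lD z (a : R) v w : 'd (map_rep pi p) z (a *: v + w) =
    a *: 'd (map_rep pi p) z v + 'd (map_rep pi p) z w by exact: linearP.
have [df ef] := diff_family (L := fun z w => 'd (map_rep pi p) z w)
  (f := fun z => z) lD (fun w => smooth_at_diff (sD w)) ex_diff (smooth_at_diff sY).
have [_ e2] := near_eq_diff (near_sec_coords_push p Y) df.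
have {}e2 := etrans (congr1 (fun h : _ -> _ => h u) e2) (ef u).
have nD : \forall z \near c, 'D_(Y p) (map_rep pi p) z = 'd (map_rep pi p) z (Y p).
  apply: filterS (near_smooth_diff sF) => z dz; exact (deriveE (Y p) dz).
have dD := smooth_at_diff (smooth_at_derive (Y p) sF).1.
have [_ e3] := near_eq_diff nD dD.
have {}e3 := congr1 (fun h : _ -> _ => h u) e3.
have did : 'd (fun z : 'rV[R]_m => z) c u = u.
  by have -> := @diff_val _ _ _ _ _ _ _ (is_diff_id c).
have cY : field_coords Y p c = Y p := field_coords_center p Y.
rewrite cY in e2.
have e4 := etrans e3 (esym (deriveE u dD)).
have e5 := congr1 ('d (fun z => 'd (map_rep pi p) z (Y p)) c) did.
have {}e2 := etrans e2 (congr1 (fun t => t + _) (etrans e5 e4)).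
rewrite e2 /hess (_ : dmap pi p (_ + _) = dmap pi p ('d (field_coords Y p) c u) +
  dmap pi p (christoffel nablaP p u (Y p))); last exact: linearD.
rewrite -dmapE; move: (dmap pi p ('d (field_coords Y p) c u)) => t.
by rewrite (addrAC _ t) opprD addrA addrK.
Qed.

Lemma hess_linl p (a : R) u v w :
  hess p (a *: u + v) w = a *: hess p u w + hess p v w.
Proof.
have dD := smooth_at_diff (smooth_at_derive w (map_rep_smooth hpi p)).1.
rewrite /hess !(deriveE _ dD) linearP (christoffel_linl hnP) !dmapP.
rewrite (christoffel_linl hnQ) scalerBr scalerDr opprD.
by rewrite (addrACA (a *: _)) (addrACA (a *: _ + _)).
Qed.

End Hessian.

Lemma hess_sym (R : realType) (m q : nat) (P : manifold R m) (Q : manifold R q)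
    (gP : tensor2 P) (gQ : tensor2 Q) (nablaP : conn_op P) (nablaQ : conn_op Q)
    (pi : P -> Q) (p : P) u w :
  levi_civita gP nablaP -> levi_civita gQ nablaQ -> smooth_map pi ->
  hess nablaP nablaQ pi p u w = hess nablaP nablaQ pi p w u.
Proof.
move=> lP lQ hpi; have [U [oU Uc FC]] := map_rep_smooth hpi p.
rewrite /hess (derive_sym_rV u w oU Uc (FC 2%N)).
by rewrite (christoffel_sym _ _ _ lP) (christoffel_sym _ _ _ lQ).
Qed.

(** * The metric and the complex structure along a map *)

Section TensorsAlongMap.
Context {R : realType} {m q : nat} {P : manifold R m} {Q : manifold R q}.
Variables (gQ : tensor2 Q) (nablaQ : conn_op Q).
Variables (J : Q -> 'rV[R]_q -> 'rV[R]_q) (pi : P -> Q).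
Hypothesis hpi : smooth_map pi.
Hypothesis hgQ : riemannian_metric gQ.
Implicit Types (p x : P) (y : Q) (W : P -> 'rV[R]_q) (u : 'rV[R]_m) (v w : 'rV[R]_q).

(** The metric as a matrix in the chart at [y]: keeping coordinate vectors apart from the base point
    makes it a family of bilinear forms, to which the product rule [diff_family] applies one slot at
    a time. *)
Definition metric_coords y (z v w : 'rV[R]_q) : R^o :=
  let x := chart_inv y z in gQ x (const_field y v x) (const_field y w x).

Lemma metric_coords_smooth y v w :
  smooth_at (fun z => metric_coords y z v w) (chart y y).
Proof. by apply: metric_smooth => //; exact: const_field_smooth. Qed.

Lemma metric_coords_linl y z (a : R) v v' w :
  metric_coords y z (a *: v + v') w =
  (a : R^o) *: metric_coords y z v w + metric_coords y z v' w.
Proof.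
have h := metric_inner_product (chart_inv y z) hgQ.
by rewrite /metric_coords {1}/const_field tchange_lin (ipDl h) (ipZl h).
Qed.

Lemma metric_coordsC y z v w : metric_coords y z v w = metric_coords y z w v.
Proof. by have [_ gs _ _] := hgQ; exact: gs. Qed.

Lemma metric_coords_linr y z (a : R) v w w' :
  metric_coords y z v (a *: w + w') =
  (a : R^o) *: metric_coords y z v w + metric_coords y z v w'.
Proof. by rewrite metric_coordsC metric_coords_linl !(metric_coordsC _ _ v). Qed.

Lemma metric_coords_center y v w : metric_coords y (chart y y) v w = gQ y v w.
Proof.
rewrite /metric_coords chartK; last exact: chart_dom_center.
by rewrite !const_field_center.
Qed.

Lemma near_metric_coords p W W' : \forall z \near chart p p,
  metric_coords (pi p) (map_rep pi p z) (sec_coords pi p W z) (sec_coords pi p W' z) =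
  (let x := chart_inv p z in gQ (pi x) (W x) (W' x)).
Proof.
apply: filterS2 (near_sec_coords hpi p W) (near_sec_coords hpi p W').
by move=> z [_ e eW] [_ _ eW']; rewrite /metric_coords e /const_field -eW -eW'.
Qed.

Lemma metric_along_smooth p W W' :
  smooth_at (sec_coords pi p W) (chart p p) ->
  smooth_at (sec_coords pi p W') (chart p p) ->
  smooth_fun_at (fun x => gQ (pi x) (W x) (W' x)) p.
Proof.
move=> sW sW'; apply: smooth_at_ext (near_metric_coords p W W') _.
apply: (@smooth_at_family _ _ _ _ _ (fun z w =>
   metric_coords (pi p) (map_rep pi p z) (sec_coords pi p W z) w) (fun z => z)) => //.
- by move=> z a w w'; exact: metric_coords_linr.
- move=> w; apply: (@smooth_at_family _ _ _ _ _ (fun z v =>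
   metric_coords (pi p) z v w) (map_rep pi p)) => //.
  + by move=> z a v v'; exact: metric_coords_linl.
  + by move=> v; rewrite map_rep_center; exact: metric_coords_smooth.
  + exact: map_rep_smooth.
- exact: smooth_at_id.
Qed.


(** The derivative has three terms, one for each coordinate section and one for the metric matrix at
    the moving base point. The last supplies the Christoffel terms that turn the other two into
    covariant derivatives. *)
Lemma metric_along_diff p W W' : levi_civita gQ nablaQ ->
  sec_diff pi W p -> sec_diff pi W' p ->
  differentiable (fun z => let x := chart_inv p z in gQ (pi x) (W x) (W' x) : R^o)
    (chart p p) /\
  forall u, dfun (fun x => gQ (pi x) (W x) (W' x)) p u =
    gQ (pi p) (pullback_conn nablaQ pi p u W) (W' p) +
    gQ (pi p) (W p) (pullback_conn nablaQ pi p u W').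
Proof.
move=> lQ dW dW'; have [hn _ compat] := lQ.
pose y := pi p; pose c := chart p p.
pose G := metric_coords y; pose F := map_rep pi p.
pose w1 := sec_coords pi p W; pose w2 := sec_coords pi p W'.
have dF : differentiable F c by exact: smooth_at_diff (map_rep_smooth hpi p).
have Fc : F c = chart y y by exact: map_rep_center.
have dG v w : differentiable (fun z => G z v w) (F c).
  by rewrite Fc; exact: smooth_at_diff (metric_coords_smooth y v w).
have GL z w (a : R) v v' : G z (a *: v + v') w = (a : R^o) *: G z v w + G z v' w.
  exact: metric_coords_linl.
have GR z v (a : R) w w' : G z v (a *: w + w') = (a : R^o) *: G z v w + G z v w'.
  exact: metric_coords_linr.
have h1 w := diff_family (L := fun z v => G z v w) (fun z => GL z w)
  (fun v => dG v w) dF dW.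
have [h2 e2] := diff_family (L := fun z w => G (F z) (w1 z) w)
  (f := fun z => z) (fun z => GR (F z) (w1 z)) (fun w => (h1 w).1) ex_diff dW'.
have [h3 e3] := near_eq_diff (near_metric_coords p W W') h2.
split; first exact h3.
move=> u; rewrite /dfun.
have {}e3 := congr1 (fun h : _ -> _ => h u) e3.
have did : 'd (fun z : 'rV[R]_m => z) c u = u.
  by have -> := @diff_val _ _ _ _ _ _ _ (is_diff_id c).
have e4 := etrans e3 (e2 u).
have e5 := congr1 ('d (fun z => G (F z) (w1 z) (w2 c)) c) did.
have e6 := etrans e5 ((h1 (w2 c)).2 u).
have {}e4 := etrans e4 (congr1 (fun t => t + _) e6).
(* Metric compatibility on [Q], applied to fields with constant coordinates. *)
have eG c' v w t : c' = chart y y -> 'd (fun z => G z v w) c' t =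
    gQ y (christoffel nablaQ y t v) w + gQ y v (christoffel nablaQ y t w).
  move=> ->; have := compat y t _ _ (const_field_smooth y v) (const_field_smooth y w).
  by rewrite !const_field_center.
have Gc v w : G (F c) v w = gQ y v w by rewrite Fc; exact: metric_coords_center.
have w1c : w1 c = W p by exact: sec_coords_center.
have w2c : w2 c = W' p by exact: sec_coords_center.
have e7 := etrans e4 (congr1 (fun t => t + _ + _) (eG (F c) (w1 c) (w2 c) _ Fc)).
rewrite [LHS]e7 !Gc w1c w2c !pullback_connE.
have ip := metric_inner_product y hgQ.
rewrite (ipDl ip) (ipDr ip).
rewrite [RHS]addrACA [RHS]addrC [RHS]addrA.
by [].
Qed.

Definition tensor_coords y (z w : 'rV[R]_q) : 'rV[R]_q :=
  field_coords (fun x : Q => J x (const_field y w x)) y z.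

Hypothesis hJ : kahler gQ nablaQ J.
Hypothesis hnQ : affine_connection nablaQ.

(** Parallelism on [Q] concerns fields on [Q], while [W] lives only along [pi] and need not extend.
    The statement is therefore transferred through the matrix of [J] in a chart. *)
Lemma pullback_complex_structure p W : sec_diff pi W p ->
  sec_diff pi (fun x => J (pi x) (W x)) p /\
  forall u, pullback_conn nablaQ pi p u (fun x => J (pi x) (W x)) =
    J (pi p) (pullback_conn nablaQ pi p u W).
Proof.
move=> dW; have [Jl sJ _ _ parJ] := hJ.
pose y := pi p; pose c := chart p p.
pose T := tensor_coords y; pose F := map_rep pi p; pose w1 := sec_coords pi p W.
have dF : differentiable F c by exact: smooth_at_diff (map_rep_smooth hpi p).
have Fc : F c = chart y y by exact: map_rep_center.
have sT w := sJ y _ (const_field_smooth y w).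
have dT w : differentiable (fun z => T z w) (F c).
  by rewrite Fc; exact: smooth_at_diff (sT w).
have TL z (a : R) w w' : T z (a *: w + w') = a *: T z w + T z w'.
  rewrite /T /tensor_coords /field_coords /const_field tchange_lin.
  by rewrite Jl tchange_lin.
have eT : \forall z \near c, T (F z) (w1 z) =
    sec_coords pi p (fun x => J (pi x) (W x)) z.
  apply: filterS (near_sec_coords hpi p W) => z [_ e eW].
  by rewrite /T /tensor_coords /field_coords /const_field e /sec_coords -eW.
have [h1 e1] := diff_family TL dT dF dW.
have [h2 e2] := near_eq_diff eT h1.
split; first exact h2.
move=> u; rewrite !pullback_connE.
have {}e2 := etrans (congr1 (fun h : _ -> _ => h u) e2) (e1 u).
(* On constant fields, [nabla J = 0] says that the derivative of the matrix of [J] is its commutator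
   with the Christoffel symbol. *)
have dTE c' w t : c' = chart y y -> 'd (fun z => T z w) c' t =
    J y (christoffel nablaQ y t w) - christoffel nablaQ y t (J y w).
  move=> ->; have e := conn_coords hnQ t (sT w).
  have e' := parJ y t _ (const_field_smooth y w).
  rewrite const_field_center in e.
  by rewrite /christoffel -[X in X - _]e' e addrK.
have Tc w : T (F c) w = J y w.
  rewrite Fc /T /tensor_coords field_coords_center.
  by rewrite const_field_center.
have w1c : w1 c = W p by exact: sec_coords_center.
have e7 := etrans e2 (congr1 (fun t => t + _) (dTE (F c) (w1 c) _ Fc)).
rewrite w1c in e7.
refine (etrans (congr1 (fun t =>
  t + christoffel nablaQ y (dmap pi p u) (J y (W p))) e7) _).
rewrite Tc.
have JD v w : J y (v + w) = J y v + J y w.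
  by have := Jl y 1 v w; rewrite !scale1r.
rewrite JD -/y -/c -/w1.
by rewrite addrAC subrK addrC.
Qed.

End TensorsAlongMap.

(** * Riemannian maps *)

Section RiemannianMaps.
Context {R : realType} {m q : nat} {P : manifold R m} {Q : manifold R q}.
Variables (gP : tensor2 P) (gQ : tensor2 Q) (pi : P -> Q).
Hypotheses (hgP : riemannian_metric gP) (hgQ : riemannian_metric gQ).
Hypothesis hpi : riemannian_map gP gQ pi.
Implicit Types (p x : P) (v w h : 'rV[R]_m) (a u : 'rV[R]_q).

Let ipP p := metric_inner_product p hgP.
Let ipQ p := metric_inner_product (pi p) hgQ.

Lemma riemannian_map_smooth : smooth_map pi. Proof. by have [] := hpi. Qed.

Lemma dker_subspace p : lin_subspace (dker pi p).
Proof.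
split=> [|a u v]; first exact: linear0.
by rewrite /dker /= dmapP => -> ->; rewrite scaler0 addr0.
Qed.

Lemma dker_orth_subspace p : lin_subspace (dker_orth gP pi p).
Proof. exact: subspace_orth (ipP p) _. Qed.

Lemma drange_subspace p : lin_subspace (drange pi p).
Proof.
split=> [|a u v [x _ <-] [y _ <-]]; first by exists 0 => //; exact: linear0.
by exists (a *: x + y) => //; rewrite dmapP.
Qed.

Lemma drange_orth_subspace p : lin_subspace (drange_orth gQ pi p).
Proof. exact: subspace_orth (ipQ p) _. Qed.

Lemma dmapD p v w : dmap pi p (v + w) = dmap pi p v + dmap pi p w.
Proof. exact: linearD. Qed.

Lemma hor_ver p v : exists h k,
  [/\ dker_orth gP pi p h, dker pi p k & v = h + k].
Proof.
have [k [X [oX DX sX]]] := exists_orthonormal_basis (ipP p) (dker_subspace p).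
exists (v - ortho_expand (gP p) X v), (ortho_expand (gP p) X v).
split; last by rewrite subrK.
  move=> w /sX ->; rewrite (ip_sumr (ipP p)) big1// => i _.
  by rewrite (ipZr (ipP p)) (ip_sub_expand (ipP p) oX) mulr0.
apply: (subspace_sum (dker_subspace p)) => i _.
exact: (subspaceZ (dker_subspace p)).
Qed.

(** The vertical part of [w] disappears on both sides, so the isometry condition extends to one
    arbitrary argument. *)
Lemma dmap_isometry p h w : dker_orth gP pi p h ->
  gQ (pi p) (dmap pi p h) (dmap pi p w) = gP p h w.
Proof.
move=> hh; have [h' [k [hh' kk ->]]] := hor_ver p w; have [_ iso _] := hpi.
by rewrite dmapD (kk : dmap pi p k = 0) addr0 iso// (ipDr (ipP p)) (hh k kk) addr0.
Qed.

Lemma oproj_horizontal p h k : dker_orth gP pi p h -> dker pi p k ->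
  oproj (gP p) (dker_orth gP pi p) (h + k) = h.
Proof.
move=> hh kk; apply: (oprojE (ipP p) (dker_orth_subspace p)) => //.
by rewrite addrAC subrr add0r => w /(_ k kk); rewrite (ipC (ipP p)).
Qed.

Lemma dmap_oproj p v :
  dmap pi p (oproj (gP p) (dker_orth gP pi p) v) = dmap pi p v.
Proof.
have [h [k [hh kk ->]]] := hor_ver p v.
by rewrite oproj_horizontal// dmapD (kk : dmap pi p k = 0) addr0.
Qed.

Lemma push_ortho p k (X : 'I_k -> 'rV[R]_m) : (forall i, dker_orth gP pi p (X i)) ->
  ortho_family (gP p) X -> ortho_family (gQ (pi p)) (fun i => dmap pi p (X i)).
Proof. by move=> hX oX i j; rewrite dmap_isometry. Qed.

Lemma push_span p k (X : 'I_k -> 'rV[R]_m) : (forall i, dker_orth gP pi p (X i)) ->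
  ortho_family (gP p) X ->
  (forall v, dker_orth gP pi p v -> exists a : 'I_k -> R, v = \sum_i a i *: X i) ->
  forall u, drange pi p u ->
    u = ortho_expand (gQ (pi p)) (fun i => dmap pi p (X i)) u.
Proof.
move=> hX oX sX u [v _ <-]; apply: (expandE (ipQ p) (push_ortho hX oX)).
have [h [l [hh ll ->]]] := hor_ver p v.
have [a ->] := sX h hh; exists a.
rewrite dmapD (ll : dmap pi p l = 0) addr0 /dmap linear_sum.
by apply: eq_bigr => i _; rewrite linearZ.
Qed.

Lemma range_part_expand p k (X : 'I_k -> 'rV[R]_m) u :
  (forall i, dker_orth gP pi p (X i)) -> ortho_family (gP p) X ->
  (forall v, dker_orth gP pi p v -> exists a : 'I_k -> R, v = \sum_i a i *: X i) ->
  range_part gQ pi p u = ortho_expand (gQ (pi p)) (fun i => dmap pi p (X i)) u.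
Proof.
move=> hX oX sX; apply: (oproj_expand (ipQ p) (push_ortho hX oX)).
- exact: drange_subspace.
- by move=> i; exists (X i).
- exact: push_span.
Qed.

(** [oproj] falls back to 0 when no projection exists, so existence has to be proved. The
    push-forward of an orthonormal horizontal basis provides it. *)
Lemma range_partP p u :
  drange pi p (range_part gQ pi p u) /\
  drange_orth gQ pi p (u - range_part gQ pi p u).
Proof.
have [k [X [oX hX sX]]] := exists_orthonormal_basis (ipP p) (dker_orth_subspace p).
have sX' v : dker_orth gP pi p v -> exists a : 'I_k -> R, v = \sum_i a i *: X i.
  by move=> /sX e; exists (fun i => gP p v (X i)).
rewrite (range_part_expand u hX oX sX'); split.
  apply: (subspace_sum (drange_subspace p)) => i _.
  by apply: (subspaceZ (drange_subspace p)); exists (X i).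
move=> w /(push_span hX oX sX') ->.
rewrite (ip_sumr (ipQ p)) big1// => i _.
by rewrite (ipZr (ipQ p)) (ip_sub_expand (ipQ p) (push_ortho hX oX)) mulr0.
Qed.

Lemma range_part_split p a u : drange pi p a -> drange_orth gQ pi p u ->
  range_part gQ pi p (a + u) = a.
Proof.
move=> ha hu; apply: (oprojE (ipQ p) (drange_subspace p)) => //.
by rewrite addrAC subrr add0r.
Qed.

Lemma normal_part_split p a u : drange pi p a -> drange_orth gQ pi p u ->
  normal_part gQ pi p (a + u) = u.
Proof.
move=> ha hu; apply: (oprojE (ipQ p) (drange_orth_subspace p)) => //.
by rewrite addrK => w /(_ a ha); rewrite (ipC (ipQ p)).
Qed.

Lemma normal_partE p u : normal_part gQ pi p u = u - range_part gQ pi p u.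
Proof.
have [h1 h2] := range_partP p u.
by rewrite -{1}(subrK (range_part gQ pi p u) u) addrC normal_part_split.
Qed.

Lemma range_part_lin p (r : R) a u :
  range_part gQ pi p (r *: a + u) = r *: range_part gQ pi p a + range_part gQ pi p u.
Proof.
have [a1 a2] := range_partP p a; have [u1 u2] := range_partP p u.
have [hr ho] := (drange_subspace p, drange_orth_subspace p).
have {1}-> : r *: a + u = (r *: range_part gQ pi p a + range_part gQ pi p u) +
    (r *: (a - range_part gQ pi p a) + (u - range_part gQ pi p u)).
  by rewrite addrACA -scalerDr !(addrC (range_part _ _ _ _)) !subrK.
by apply: range_part_split; [exact: hr.2|exact: ho.2].
Qed.

Lemma normal_part_lin p (r : R) a u : normal_part gQ pi p (r *: a + u) =
  r *: normal_part gQ pi p a + normal_part gQ pi p u.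
Proof.
by rewrite !normal_partE range_part_lin opprD addrACA scalerBr.
Qed.

(* [pi_*] is isometric on horizontal vectors, so the adjoint of [pi_*] composed
   with [pi_*] is the horizontal projector. It depends smoothly on the point, which
   yields smooth horizontal and vertical frames, and in particular constancy of
   the rank. *)
Lemma projector_horizontal p (E : 'I_m -> 'rV[R]_m) h k : ortho_family (gP p) E ->
  dker_orth gP pi p h -> dker pi p k ->
  \sum_i gQ (pi p) (dmap pi p (h + k)) (dmap pi p (E i)) *: E i = h.
Proof.
move=> oE hh kk; rewrite [RHS](orthonormal_full (ipP p) h oE).
apply: eq_bigr => i _; rewrite dmapD (kk : dmap pi p k = 0) addr0.
by rewrite dmap_isometry.
Qed.

Lemma exists_adapted_frames p : exists k1 (X : 'I_k1 -> P -> 'rV[R]_m)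
    k2 (V : 'I_k2 -> P -> 'rV[R]_m),
  frame_near gP (dker_orth gP pi) p X /\ frame_near gP (dker pi) p V.
Proof.
have hs := riemannian_map_smooth.
have [E [sE oE]] := exists_orthonormal_frame hgP p.
have oEp : ortho_family (gP p) (E^~ p) := nbhs_singleton oE.
(* The horizontal projector written in the frame [E]. Its coefficients involve only the metric and
   the differential of [pi], so it is smooth before anything is known about how the kernel
   varies. *)
pose T Y : P -> 'rV[R]_m := fun x =>
  \sum_i gQ (pi x) (dmap pi x (Y x)) (dmap pi x (E i x)) *: E i x.
have sT Y : field_smooth_at Y p -> field_smooth_at (T Y) p.
  move=> sY; apply: field_smooth_sum => i; apply: field_smoothZ => //.
  by apply: (metric_along_smooth hs hgQ (W := push pi Y) (W' := push pi (E i)));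
    exact: push_smooth.
have hT Y : \forall x \near p,
    dker_orth gP pi x (T Y x) /\ dker pi x (Y x - T Y x).
  apply: filterS oE => x oEx; have [h [k [hh kk e]]] := hor_ver x (Y x).
  rewrite /T e (projector_horizontal oEx hh kk); split=> //.
  by rewrite addrAC subrr add0r.
have cs := const_field_smooth p.
have cc := const_field_center p.
have [|w hw|k1 [X [sX nX spX]]] :=
    exists_local_frame hgP (D := dker_orth gP pi) (p := p).
- exact: dker_orth_subspace.
- exists (T (const_field p w)); split; first exact: sT.
    have := projector_horizontal oEp hw (dker_subspace p).1.
    by rewrite addr0 /T cc.
  by apply: filterS (hT (const_field p w)) => x [].
have [|w hw|k2 [V [sV nV spV]]] :=
    exists_local_frame hgP (D := dker pi) (p := p).
- exact: dker_subspace.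
- exists (fun x => const_field p w x - T (const_field p w) x); split.
  + by apply: field_smoothB => //; exact: sT.
  + have := projector_horizontal oEp (dker_orth_subspace p).1 hw.
    by rewrite add0r /T cc => ->; rewrite subr0.
  + by apply: filterS (hT (const_field p w)) => x [].
have oXV x : ortho_family (gP x) (X^~ x) -> ortho_family (gP x) (V^~ x) ->
    (forall i, dker_orth gP pi x (X i x)) -> (forall i, dker pi x (V i x)) ->
    ortho_family (gP x) (family_sum (X^~ x) (V^~ x)).
  move=> oX oV hX hV; apply: (family_sum_ortho (ipP x)) => // i j.
  exact: hX.
(* The two sizes are counted at [p], where both systems span. As the joint family stays orthonormal
   nearby, this count makes it a basis there too; a horizontal or vertical vector then has no
   coefficient in the other block. *)
have cI : #|{: 'I_k1 + 'I_k2}| = m.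
  have [oX hX] := nbhs_singleton nX; have [oV hV] := nbhs_singleton nV.
  have o := oXV p oX oV hX hV.
  apply/eqP; rewrite eqn_leq (orthonormal_card (ipP p) o) /=.
  apply: (span_card (X := family_sum (X^~ p) (V^~ p))) => v.
  have [h [k [hh kk ->]]] := hor_ver p v.
  exact: family_sum_span (spX h hh) (spV k kk).
exists k1, X, k2, V; split; split=> //.
- apply: filterS2 nX nV => x [oX hX] [oV hV]; split; [exact: hX|exact: oX|move=> v hv].
  exists (fun i => gP x v (X i x)).
  rewrite [LHS](orthonormal_span (ipP x) v (oXV x oX oV hX hV) cI).
  rewrite /ortho_expand big_sumType /= [X in _ + X]big1 ?addr0// => i _.
  by rewrite hv// scale0r.
- apply: filterS2 nX nV => x [oX hX] [oV hV]; split; [exact: hV|exact: oV|move=> v hv].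
  exists (fun i => gP x v (V i x)).
  rewrite [LHS](orthonormal_span (ipP x) v (oXV x oX oV hX hV) cI).
  rewrite /ortho_expand big_sumType /= [X in X + _]big1 ?add0r// => i _.
  by rewrite (ipC (ipP x)) hX// scale0r.
Qed.

End RiemannianMaps.

(** * The slant identity and the tension field *)

Section Harmonicity.
Context {R : realType} {m q : nat} {P : manifold R m} {Q : manifold R q}.
Variables (gP : tensor2 P) (gQ : tensor2 Q) (nablaP : conn_op P) (nablaQ : conn_op Q).
Variables (J : Q -> 'rV[R]_q -> 'rV[R]_q) (pi : P -> Q) (theta : R).
Hypotheses (hgP : riemannian_metric gP) (hgQ : riemannian_metric gQ).
Hypotheses (lP : levi_civita gP nablaP) (lQ : levi_civita gQ nablaQ).
Hypothesis hJ : kahler gQ nablaQ J.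
Hypothesis hpi : riemannian_map gP gQ pi.
Hypothesis hslant : slant gP gQ J pi theta.
Implicit Types (p x : P) (v w h : 'rV[R]_m) (a u : 'rV[R]_q).

Let ipP p := metric_inner_product p hgP.
Let ipQ p := metric_inner_product (pi p) hgQ.
Let hs : smooth_map pi := riemannian_map_smooth hpi.
Let nP : affine_connection nablaP. Proof. by case: lP. Qed.
Let nQ : affine_connection nablaQ. Proof. by case: lQ. Qed.

Lemma J_skew y a u : gQ y (J y a) u = - gQ y a (J y u).
Proof.
have [_ _ JJ Jg _] := hJ; have ip := metric_inner_product y hgQ.
rewrite -(Jg y a (J y u)) JJ -[- u]scaleN1r (ipZr ip).
by rewrite mulN1r opprK.
Qed.

Lemma drangeP p u : drange pi p u -> exists2 h, dker_orth gP pi p h & u = dmap pi p h.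
Proof.
move=> [v _ <-]; have [h [k [hh kk ->]]] := hor_ver pi hgP p v.
by exists h => //; rewrite dmapD (kk : dmap pi p k = 0) addr0.
Qed.

Lemma alpha_range p u : drange pi p (alpha_part gQ J pi p u).
Proof. exact: (range_partP hgP hgQ hpi p _).1. Qed.

Lemma alpha_pairing p a u : drange pi p u ->
  gQ (pi p) (alpha_part gQ J pi p a) u = gQ (pi p) (J (pi p) a) u.
Proof.
move=> hu; have [_ na] := range_partP hgP hgQ hpi p (J (pi p) a).
by have := na _ hu; rewrite (ipBl (ipQ p)) => /eqP; rewrite subr_eq0 => /eqP.
Qed.

(** As [J] is isometric, the cosine of the angle between [J w] and its projection [alpha w] is the
    ratio of the norms of [alpha w] and [w]. *)
Lemma slant_norm p u : drange pi p u ->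
  gQ (pi p) (alpha_part gQ J pi p u) (alpha_part gQ J pi p u) =
  cos theta ^+ 2 * gQ (pi p) u u.
Proof.
move=> /drangeP[h hh ->]; set w := dmap pi p h.
have [_ _ JJ Jg _] := hJ.
have ra := alpha_range p w.
have [h0|h0] := eqVneq h 0.
  have w0 : w = 0 by rewrite /w h0; exact: linear0.
  rewrite alpha_pairing// J_skew {1}w0 (ip0l (ipQ p)) oppr0.
  by rewrite [in RHS]w0 (ip0l (ipQ p)) mulr0.
have := hslant hh h0; rewrite -/w /angle_subspace /angle -/(range_part gQ pi p _).
rewrite -/(alpha_part gQ J pi p w).
set A := alpha_part gQ J pi p w in ra *; set b := gQ (pi p).
have na : drange_orth gQ pi p (J (pi p) w - A).
  exact: (range_partP hgP hgQ hpi p (J (pi p) w)).2.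
have bA : b (J (pi p) w) A = b A A by rewrite /b -alpha_pairing.
have w0 : 0 < b w w.
  by rewrite /b (dmap_isometry hgP hpi)//; have [_ _ gp _] := hgP; exact: gp.
have bJ : b (J (pi p) w) (J (pi p) w) = b w w by exact: Jg.
(* Pythagoras for [J w]. It places the quotient of norms in the interval on which [cos] inverts
   [acos]. *)
have le : b A A <= b w w.
  have ip : inner_product b := ipQ p.
  set D := J (pi p) w - A in na; have o : b D A = 0 := na A ra.
  have -> : b w w = b (D + A) (D + A) by rewrite subrK.
  clearbody D; rewrite (ipDl ip) !(ipDr ip).
  by rewrite (ipC ip A D) o addr0 add0r lerDr ip_ge0.
have A0 : 0 <= b A A by exact: ip_ge0 (ipQ p) A.
rewrite bA bJ; set s := Num.sqrt (b w w); set t := Num.sqrt (b A A).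
have s0 : 0 < s by rewrite sqrtr_gt0.
have t0 : 0 <= t by exact: sqrtr_ge0.
have ts : t <= s by rewrite ler_sqrt// ltW.
have At : b A A = t ^+ 2 by rewrite sqr_sqrtr.
have ws : b w w = s ^+ 2 by rewrite sqr_sqrtr// ltW.
rewrite At ws.
(* Also valid for [t = 0], where division by zero gives 0 and the angle is pi/2. *)
have -> : t ^+ 2 / (s * t) = t / s.
  have [->|tn0] := eqVneq t 0; first by rewrite expr0n /= !mul0r.
  by rewrite expr2 -mulf_div divff// mulr1.
move=> <-; rewrite acosK.
  by rewrite expr_div_n divfK// expf_neq0// gt_eqF.
rewrite in_itv /=; apply/andP; split.
  by rewrite (le_trans _ (divr_ge0 t0 (ltW s0)))// lerN10.
by rewrite ler_pdivrMr// mul1r.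
Qed.

Lemma alpha_lin p (r : R) a u : alpha_part gQ J pi p (r *: a + u) =
  r *: alpha_part gQ J pi p a + alpha_part gQ J pi p u.
Proof.
by have [Jl _ _ _ _] := hJ; rewrite /alpha_part Jl (range_part_lin hgP hgQ hpi).
Qed.

(** Polarizing [slant_norm] shows that [alpha] multiplies inner products on the range by [c]. Since
    [alpha] is skew there, [alpha] squared is [- c] against every vector of the range. *)
Lemma alpha_sq p u : drange pi p u ->
  alpha_part gQ J pi p (alpha_part gQ J pi p u) = - (cos theta ^+ 2 *: u).
Proof.
move=> hu; set c := cos theta ^+ 2; pose al := alpha_part gQ J pi p.
pose b := gQ (pi p); have ip : inner_product b := ipQ p.
have hr := drange_subspace pi p.
have polar (w : 'rV[R]_q) : drange pi p w -> b (al u) (al w) = c * b u w.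
  move=> hw; have h1 : b (al u) (al u) = c * b u u := slant_norm hu.
  have h2 : b (al w) (al w) = c * b w w := slant_norm hw.
  have alD : al (u + w) = al u + al w.
    by have := alpha_lin p 1 u w; rewrite !scale1r.
  have : b (al u + al w) (al u + al w) = c * b (u + w) (u + w).
    by rewrite -alD; exact: slant_norm (subspaceD hr hu hw).
  rewrite !(ipDl ip) !(ipDr ip) (ipC ip (al w) (al u)) (ipC ip w u) h1 h2.
  by move=> h3; lra.
apply/eqP; rewrite -subr_eq0 opprK; apply/eqP.
have hd : drange pi p (al (al u) + c *: u).
  by apply: subspaceD => //; [exact: alpha_range|exact: subspaceZ].
suff o (w : 'rV[R]_q) : drange pi p w -> b (al (al u) + c *: u) w = 0.
  by apply: (ip_eq0 ip); exact: o.
move=> hw; rewrite (ipDl ip) (ipZl ip).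
have -> : b (al (al u)) w = - b (al u) (al w).
  rewrite /b alpha_pairing// J_skew (ipC (ipQ p)) -alpha_pairing; last exact: alpha_range.
  by rewrite (ipC (ipQ p)).
by rewrite polar// addNr.
Qed.

Lemma frame_center (g : tensor2 P) (D : P -> set 'rV[R]_m) p k
    (X : 'I_k -> P -> 'rV[R]_m) : riemannian_metric g -> frame_near g D p X ->
  [/\ forall i, D p (X i p), ortho_family (g p) (X^~ p) &
      forall v, D p v -> v = ortho_expand (g p) (X^~ p) v].
Proof.
move=> hg [_ /nbhs_singleton[DX oX sX]]; split=> // v /sX.
exact: (expandE (metric_inner_product p hg) oX).
Qed.

(* [alpha] is smooth along [pi] because, in a horizontal frame, it is given by the
   functions [g_Q (J (pi_* X_i), pi_* X_j)]. *)
Lemma alpha_diff p k (X : 'I_k -> P -> 'rV[R]_m) i :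
  frame_near gP (dker_orth gP pi) p X ->
  sec_diff pi (fun x => alpha_part gQ J pi x (push pi (X i) x)) p.
Proof.
move=> [sX nX]; have dp j : sec_diff pi (push pi (X j)) p by exact: push_diff.
have [dJ _] := pullback_complex_structure hs hJ nQ (dp i).
have d : sec_diff pi (fun x => \sum_j gQ (pi x) (J (pi x) (push pi (X i) x))
    (push pi (X j) x) *: push pi (X j) x) p.
  apply: sec_diff_sum => j; apply: sec_diffZ => //.
  exact: (metric_along_diff hs hgQ lQ dJ (dp j)).1.
apply: (pullback_ext nablaQ 0 _ d).1.
apply: filterS nX => x [hX oX spX].
by rewrite /alpha_part (range_part_expand hgP hgQ hpi _ hX oX spX).
Qed.

Lemma harmonicity_integrandE p k (X : 'I_k -> P -> 'rV[R]_m) i :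
  frame_near gP (dker_orth gP pi) p X ->
  harmonicity_integrand gQ nablaQ J pi p (X i) =
  sin theta ^+ 2 *:
    normal_part gQ pi p (pullback_conn nablaQ pi p (X i p) (push pi (X i))).
Proof.
move=> fX; have [sX _] := fX; have [Jl _ JJ _ _] := hJ.
pose W := push pi (X i); pose A x := alpha_part gQ J pi x (W x).
pose c := cos theta ^+ 2; pose D W := pullback_conn nablaQ pi p (X i p) W.
pose np := normal_part gQ pi p; pose Jp := J (pi p).
have dW : sec_diff pi W p by exact: push_diff.
have dA : sec_diff pi A p by exact: alpha_diff fX.
have [dJW eJW] := pullback_complex_structure hs hJ nQ dW.
have [dJA eJA] := pullback_complex_structure hs hJ nQ dA.
have WR x : drange pi x (W x) by exists (X i x).
(* Both [delta] sections are rewritten without the normal projection, as combinations of [W], [A],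
   [J W] and [J A], which are known to be differentiable. The form [a *: _ + _] is the one
   [pullback_lin] expects. *)
have deltaE : (fun x => delta_part gQ J pi x (W x)) =
    (fun x => (-1 : R) *: A x + J (pi x) (W x)).
  apply/funext => x.
  by rewrite /delta_part (normal_partE hgP hgQ hpi) scaleN1r addrC.
have delta_alphaE : (fun x => delta_part gQ J pi x (alpha_part gQ J pi x (W x))) =
    (fun x => c *: W x + J (pi x) (A x)).
  apply/funext => x; rewrite /delta_part (normal_partE hgP hgQ hpi).
  rewrite -[range_part _ _ _ _]/(alpha_part gQ J pi x (A x)).
  by rewrite alpha_sq// opprK addrC.
have npl r a u : np (r *: a + u) = r *: np a + np u.
  exact: (normal_part_lin hgP hgQ hpi).
have [npN npD] := lin_funP npl.
have [JN JD] : (forall a, Jp (- a) = - Jp a) /\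
    (forall a u, Jp (a + u) = Jp a + Jp u) := lin_funP (Jl (pi p)).
have JJp u : Jp (Jp u) = - u by exact: JJ.
rewrite /harmonicity_integrand /Defs.shape /normal_conn -/W deltaE delta_alphaE.
have [_ ->] := pullback_lin (X i p) c nQ dW dJA.
have [_ ->] := pullback_lin (X i p) (-1) nQ dA dJW.
set a := D A; set w := D W.
rewrite -/(D W) -/(D A) eJW eJA /delta_part /C_part -/np -/Jp -/a -/w.
set v := -1 *: a + Jp w; set r := range_part gQ pi p v.
have nv : np v = v - r by exact: (normal_partE hgP hgQ hpi).
(* Here [v] is the derivative of [delta W], and [- r] is its shape term. The [delta] and [C] terms
   of the integrand thus recombine into [- np (Jp v)]. *)
have Jv : np (Jp r) = np (Jp v) - np (Jp (np v)).
  by rewrite nv (JD v) JN npD npN opprB addrC subrK.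
have vE : np (Jp v) = - np (Jp a) - np w.
  by rewrite /v scaleN1r JD JN JJp npD !npN.
rewrite JN npN Jv vE npl sin2cos2 -/c.
move: (np (Jp (np v))) (np (Jp a)) (np w) => t1 t2 t3.
by apply/rowP => l; rewrite !mxE; ring.
Qed.

Let tri p (X Y Z : P -> 'rV[R]_m) :=
  gQ (pi p) (hess nablaP nablaQ pi p (X p) (Y p)) (dmap pi p (Z p)).

(** The products of the frame fields and of their push-forwards are locally constant, so
    compatibility of each connection with its metric makes each of the two terms of the second
    fundamental form skew in [j] and [l]. *)
Lemma hess_skew p k (X : 'I_k -> P -> 'rV[R]_m) i j l :
  frame_near gP (dker_orth gP pi) p X -> tri p (X i) (X j) (X l) = - tri p (X i) (X l) (X j).
Proof.
move=> fX; have [sX nX] := fX; have [hX _ _] := frame_center hgP fX.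
have dp l' : sec_diff pi (push pi (X l')) p by exact: push_diff.
have [_ _ compat] := lP.
have eP : gP p (nablaP p (X i p) (X j)) (X l p) +
    gP p (X j p) (nablaP p (X i p) (X l)) = 0.
  rewrite -compat// -(dfun_cst p ((j == l)%:R : R) (X i p)).
  apply/esym/dfun_ext; last exact: smooth_fun_cst.
  by apply: filterS nX => x [_ oX _].
have eQ : gQ (pi p) (pullback_conn nablaQ pi p (X i p) (push pi (X j))) (push pi (X l) p) +
    gQ (pi p) (push pi (X j) p) (pullback_conn nablaQ pi p (X i p) (push pi (X l))) = 0.
  rewrite -(metric_along_diff hs hgQ lQ (dp j) (dp l)).2.
  rewrite -(dfun_cst p ((j == l)%:R : R) (X i p)).
  apply/esym/dfun_ext; last exact: smooth_fun_cst.
  apply: filterS nX => x [hXx oX _].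
  by rewrite (push_ortho hgP hpi hXx oX).
rewrite /tri -!(second_fund_formE nablaQ hs nP)// /second_fund_form !(ipBl (ipQ p)).
rewrite (ipC (ipQ p) (dmap _ _ _)) (dmap_isometry hgP hpi)//.
rewrite (ipC (ipQ p) (dmap _ _ (nablaP _ _ (X l)))) (dmap_isometry hgP hpi)//.
rewrite (ipC (ipP p) (X l p)) [gQ _ _ (dmap pi p (X j p))](ipC (ipQ p)).
have -> : gP p (nablaP p (X i p) (X j)) (X l p) = - gP p (X j p) (nablaP p (X i p) (X l)).
  by apply/eqP; rewrite -addr_eq0 eP.
have -> : gQ (pi p) (pullback_conn nablaQ pi p (X i p) (push pi (X j)))
    (dmap pi p (X l p)) = - gQ (pi p) (dmap pi p (X j p))
      (pullback_conn nablaQ pi p (X i p) (push pi (X l))).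
  by apply/eqP; rewrite -addr_eq0 eQ.
by rewrite opprK opprB addrC.
Qed.

Lemma hess_normal p k (X : 'I_k -> P -> 'rV[R]_m) i j :
  frame_near gP (dker_orth gP pi) p X ->
  drange_orth gQ pi p (hess nablaP nablaQ pi p (X i p) (X j p)).
Proof.
move=> fX; have [hX oX sX] := frame_center hgP fX.
have sk := fun i j l => hess_skew i j l fX.
have sy i' j' l' : tri p (X i') (X j') (X l') = tri p (X j') (X i') (X l').
  by rewrite /tri (hess_sym p (X i' p) (X j' p) lP lQ hs).
have t0 l : tri p (X i) (X j) (X l) = 0.
  (* Alternating three skew exchanges of the last two slots with three symmetric exchanges of the
     first two returns to the original order with an odd sign. *)
  have h : tri p (X i) (X j) (X l) = - tri p (X i) (X j) (X l).
    rewrite {1}(sk i j l) (sy i l j) (sk l i j) opprK (sy l j i) (sk j l i).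
    by rewrite (sy j i l).
  by lra.
move=> u [v _ <-]; have [h [n [hh nn ->]]] := hor_ver pi hgP p v.
rewrite dmapD (nn : dmap pi p n = 0) addr0 (sX h hh) /dmap linear_sum.
rewrite (ip_sumr (ipQ p)) big1// => l _.
rewrite linearZ (ipZr (ipQ p)) -[gQ _ _ _]/(tri p (X i) (X j) (X l)).
by rewrite t0 mulr0.
Qed.

Lemma harmonicity_integrand_hess p k (X : 'I_k -> P -> 'rV[R]_m) i :
  frame_near gP (dker_orth gP pi) p X ->
  harmonicity_integrand gQ nablaQ J pi p (X i) =
  sin theta ^+ 2 *: hess nablaP nablaQ pi p (X i p) (X i p).
Proof.
move=> fX; have [sX _] := fX; rewrite (harmonicity_integrandE i fX); congr (_ *: _).
have e := second_fund_formE nablaQ hs nP (X i) (sX i).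
rewrite -[pullback_conn _ _ _ _ _](subrK (dmap pi p (nablaP p (X i p) (X i)))).
rewrite -/(second_fund_form nablaP nablaQ pi p (X i) (X i)) e addrC.
apply: (normal_part_split hgQ); first by exists (nablaP p (X i p) (X i)).
exact: hess_normal fX.
Qed.

Lemma hess_vertical p k (V : 'I_k -> P -> 'rV[R]_m) i :
  frame_near gP (dker pi) p V ->
  hess nablaP nablaQ pi p (V i p) (V i p) = - dmap pi p (nablaP p (V i p) (V i)).
Proof.
move=> [sV nV]; rewrite -(second_fund_formE nablaQ hs nP (V i) (sV i)).
have d := push_diff hs (sV i).
(* The push-forward of [V i] vanishes near [p], hence agrees there with [- W + W]; locality and
   linearity then make its derivative zero. *)
have [dZ eZ] := pullback_lin (V i p) (-1) nQ d d.
have n0 : \forall x \near p, (-1 : R) *: push pi (V i) x + push pi (V i) x =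
    push pi (V i) x.
  apply: filterS nV => x [/(_ i) DV _ _].
  by rewrite /push (DV : dmap pi x (V i x) = 0) scaler0 addr0.
have [_ e] := pullback_ext nablaQ (V i p) n0 dZ.
by rewrite /second_fund_form -e eZ scaleN1r addNr add0r.
Qed.

Lemma hess_linr p (a : R) (u v w : 'rV[R]_m) : hess nablaP nablaQ pi p u (a *: v + w) =
  a *: hess nablaP nablaQ pi p u v + hess nablaP nablaQ pi p u w.
Proof.
rewrite (hess_sym p u _ lP lQ hs) (hess_linl hs nP nQ).
by rewrite (hess_sym p v u lP lQ hs) (hess_sym p w u lP lQ hs).
Qed.

(** Neither given frame is adapted to the splitting of the tangent space, so both traces are moved
    to an auxiliary horizontal frame [X'] and vertical frame [V]. *)
Lemma trace_second_fund_form p k l (X : 'I_k -> P -> 'rV[R]_m)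
    (Z : 'I_l -> P -> 'rV[R]_m) : minimal_kernel gP nablaP pi ->
  frame_near gP (dker_orth gP pi) p X -> frame_near gP (fun=> setT) p Z ->
  \sum_i second_fund_form nablaP nablaQ pi p (Z i) (Z i) =
  \sum_i hess nablaP nablaQ pi p (X i p) (X i p).
Proof.
move=> hmin fX fZ.
have [k1 [X' [k2 [V [fX' fV]]]]] := exists_adapted_frames hgP hgQ hpi p.
have [hX oX sX] := frame_center hgP fX.
have [hX' oX' sX'] := frame_center hgP fX'.
have [hV oV sV] := frame_center hgP fV.
have [hZ oZ sZ] := frame_center hgP fZ.
transitivity (\sum_i hess nablaP nablaQ pi p (X' i p) (X' i p)); last first.
  apply: (trace_indep (ipP p) (B := hess nablaP nablaQ pi p)) oX' oX _ _.
  - by move=> a u v w; exact: (hess_linl hs nP nQ).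
  - by move=> a u v w; exact: hess_linr.
  - by move=> i; exact: sX.
  - by move=> i; exact: sX'.
pose Y := family_sum (X'^~ p) (V^~ p).
have oY : ortho_family (gP p) Y.
  by apply: (family_sum_ortho (ipP p)) => // i j; exact: hX'.
have sY v : v = ortho_expand (gP p) Y v.
  apply: (expandE (ipP p) oY); have [h [n [hh nn ->]]] := hor_ver pi hgP p v.
  exact: family_sum_span (sX' h hh) (sV n nn).
transitivity (\sum_i hess nablaP nablaQ pi p (Y i) (Y i)).
  have [sZ' _] := fZ.
  under eq_bigr => i _ do rewrite (second_fund_formE nablaQ hs nP (Z i) (sZ' i)).
  apply: (trace_indep (ipP p) (B := hess nablaP nablaQ pi p)) oZ oY _ _.
  - by move=> a u v w; exact: (hess_linl hs nP nQ).
  - by move=> a u v w; exact: hess_linr.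
  - by move=> i; exact: sY.
  - by move=> j; exact: sZ.
rewrite big_sumType /= [X in _ + X](_ : _ = 0) ?addr0//.
(* The differential of [pi] ignores vertical parts, so the horizontal projection can be inserted;
   the vertical sum becomes minus the image of the mean curvature of the fibers. *)
under eq_bigr => i _ do rewrite (hess_vertical i fV) -(dmap_oproj pi hgP).
rewrite sumrN -linear_sum.
have -> := hmin p _ (ex_intro _ k2 (ex_intro _ V (conj fV erefl))).
by rewrite linear0 oppr0.
Qed.

End Harmonicity.

Theorem theorem3p8 (R : realType) (m q : nat)
  (P : manifold R m) (Q : manifold R q)
  (gP : tensor2 P) (gQ : tensor2 Q)
  (nablaP : conn_op P) (nablaQ : conn_op Q)
  (J : Q -> 'rV[R]_q -> 'rV[R]_q) (pi : P -> Q) (f : Q -> R) (theta : R)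
  (hgP : riemannian_metric gP) (hgQ : riemannian_metric gQ)
  (hnablaP : levi_civita gP nablaP) (hnablaQ : levi_civita gQ nablaQ)
  (hJ : kahler gQ nablaQ J)
  (hpi : riemannian_map gP gQ pi)
  (hslant : slant gP gQ J pi theta)
  (hsin : sin theta != 0)
  (hf : smooth_fun f)
  (hclairaut : clairaut gQ nablaQ pi (fun y => expR (f y)))
  (htg : totally_geodesic_normal gQ nablaQ pi)
  (hmin : minimal_kernel gP nablaP pi) :
  harmonic_map gP nablaP nablaQ pi <->
  (forall p t,
     is_trace gP (dker_orth gP pi) (harmonicity_integrand gQ nablaQ J pi) p t ->
     ((csc theta) ^+ 2 / q%:R) *: t = 0).
Proof.
have trace_integrand p k (X : 'I_k -> P -> 'rV[R]_m) :
    frame_near gP (dker_orth gP pi) p X ->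
    \sum_i harmonicity_integrand gQ nablaQ J pi p (X i) =
    sin theta ^+ 2 *: \sum_i hess nablaP nablaQ pi p (X i p) (X i p).
  move=> fX; rewrite scaler_sumr; apply: eq_bigr => i _.
  exact: (harmonicity_integrand_hess hgP hgQ hnablaP hnablaQ hJ hpi hslant i fX).
have trace_sff := trace_second_fund_form hgP hgQ hnablaP hnablaQ hpi hmin.
split=> [harm p t [k [X [fX ->]]]|hint p t [l [Z [fZ ->]]]].
  have [Z [sZ oZ]] := exists_orthonormal_frame hgP p.
  have fZ : frame_near gP (fun=> setT) p Z.
    split=> //; apply: filterS oZ => x oZx; split=> // v _.
    exists (fun i => gP x v (Z i x)).
    exact: (orthonormal_full (metric_inner_product x hgP) v oZx).
  rewrite trace_integrand// -(trace_sff _ _ _ _ _ fX fZ).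
  rewrite (harm p (\sum_i second_fund_form nablaP nablaQ pi p (Z i) (Z i))).
    by rewrite !scaler0.
  by exists m, Z.
have [k [X [k' [V [fX _]]]]] := exists_adapted_frames hgP hgQ hpi p.
(* For [q = 0] the coefficient would be 0 by convention. The nonzero normal vector required of a
   Riemannian map excludes this case. *)
have q0 : q%:R != 0 :> R.
  have [_ _ /(_ p)[u _ u0]] := hpi; rewrite pnatr_eq0.
  by apply: contraNneq u0 => q0; move: u; rewrite q0 => u; apply/eqP/rowP => -[].
have := hint p _ (ex_intro _ k (ex_intro _ X (conj fX erefl))).
rewrite trace_integrand// (trace_sff _ _ _ _ _ fX fZ) scalerA => /eqP.
rewrite scaler_eq0 => /orP[|/eqP//].
(* The cosecant cancels the factor [sin theta ^+ 2] of the integrand, which leaves the nonzero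
   coefficient [1 / q]. *)
by rewrite /csc exprVn mulrAC mulVf ?expf_neq0// mul1r invr_eq0 (negbTE q0).
Qed.
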